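(* Let $(\lambda_\alpha)_{\alpha\in(0,\alpha_1]}$ be drift rates such that $\mathcal{V}_\alpha=\mathcal{V}_0+\alpha\mathcal{M}$ is $(\lambda_\alpha,A'_\alpha)$-admissible for $\mathcal{L}_\alpha$ and $\lambda_\alpha\ge\lambda+\delta\alpha-C_\lambda\alpha^2$ for all $\alpha\in(0,\alpha_1]$. Assume $D:=\delta-\gamma\lambda>0$. For $\alpha\ge0$ and $\ell>0$ let $\Lambda_\alpha(\ell):=J_2\frac{(1+\alpha\gamma)L}{\ell}$, let $\Lambda_0:=\Lambda_0(\lambda)=J_2L/\lambda$ and assume $\Lambda_0>\frac12$. Define $h(x):=\sqrt x\,e^{-x}$ and $M_h:=\sup_{x\in[\Lambda_0/2,\Lambda_0]}\left|\frac{x^2-x-1/4}{x^{3/2}}e^{-x}\right|$. Put $$\alpha_{\mathrm{metric,acc}}:=\min\left\{\alpha_1,\,1,\,\frac{D}{4C_\lambda},\,\sqrt{\frac{\lambda}{2C_\lambda}},\,\frac{4\lambda}{D},\,\frac{8\lambda^2\sqrt{\Lambda_0}e^{-\Lambda_0}\left(1-\frac1{2\Lambda_0}\right)}{J_2L\,D\,M_h}\right\},$$ with the terms involving $C_\lambda$ omitted when $C_\lambda=0$. Then for all $\alpha\in(0,\alpha_{\mathrm{metric,acc}}]$: (i) $\Lambda_\alpha(\lambda_\alpha)\le\Lambda_0-c_\Lambda\alpha$, where $c_\Lambda:=\frac18J_2L\frac{D}{\lambda^2}>0$. (ii) There exist explicit constants $c_2,c_3>0$ such that $$\widetilde\Lambda_{2,\alpha}(\lambda_\alpha)\ge\widetilde\Lambda_{2,0}(\lambda)(1+c_2\alpha),\qquad\widetilde\Lambda_{3,\alpha}(\lambda_\alpha)\ge\widetilde\Lambda_{3,0}(\lambda)(1+c_3\alpha),$$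 where $\widetilde\Lambda_{2,\alpha}(\ell):=h(\Lambda_\alpha(\ell))\frac{L_{\mathrm{eff}}(\alpha)}{\gamma^2}$, $\widetilde\Lambda_{3,\alpha}(\ell):=\kappa_{\mathrm{adjust}}h(\Lambda_\alpha(\ell))$ and $L_{\mathrm{eff}}(\alpha)=(1+\alpha\gamma)L$. More precisely, one may take any $c_3<c_3^*:=\frac12\left(1-\frac1{2\Lambda_0}\right)c_\Lambda$ and then $c_2:=\gamma+c_3$.
   Context: Fix an integer $d\ge1$, $\gamma>0$ and $\kappa_{\mathrm{adjust}}\in(0,1)$; $|\cdot|$ is the Euclidean norm, $\|\cdot\|_{\mathrm{op}}$ the operator norm; points of $\mathbb{R}^{2d}$ are $z=(q,p)$. Assumption 1 on $U:\mathbb{R}^d\to\mathbb{R}$: there are constants $L,A\in(0,\infty)$, $\lambda\in(0,1/4]$ such that (i) $U\in C^1$, $U\ge0$; (ii) $\nabla U$ is $L$-Lipschitz; (iii) $\frac12q\cdot\nabla U(q)\ge\lambda\left(U(q)+\frac{\gamma^2}{4}|q|^2\right)-A$ for all $q$. Put $\mathcal{V}_0(q,p)=U(q)+\frac{\gamma^2}{4}\left(|q+\gamma^{-1}p|^2+|\gamma^{-1}p|^2-\lambda|q|^2\right)$. Assumption 2: there are $C_{\mathrm{linear}}>0$, a symmetric positive definite $Q_\infty\in\mathbb{R}^{d\times d}$ and a nonincreasing $\varrho:[0,\infty)\to[0,\infty)$ with $\varrho(r)\to0$ as $r\to\infty$ and $|\nabla U(q)-Q_\infty q|\le\varrho(|q|)|q|$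 for $|q|\ge C_{\mathrm{linear}}$. Generator of the HFHR dynamics: $\mathcal{L}_\alpha\varphi=(p-\alpha\nabla U)\cdot\nabla_q\varphi+(-\gamma p-\nabla U)\cdot\nabla_p\varphi+\alpha\Delta_q\varphi+\gamma\Delta_p\varphi$. Put $\mathcal{A}_0:=p\cdot\nabla_q+(-\gamma p-\nabla U)\cdot\nabla_p$, $\mathcal{A}':=-\nabla U\cdot\nabla_q$. A function $\mathcal{V}:\mathbb{R}^{2d}\to[0,\infty)$, $C^2$ or $C^1$ with locally Lipschitz derivatives, is $(\ell,E)$-admissible for $\mathcal{L}_\alpha$ if $\mathcal{L}_\alpha\mathcal{V}\le\gamma(d+E-\ell\mathcal{V})$ a.e. Corrector: let $B=\begin{pmatrix}0&I_d\\-Q_\infty&-\gamma I_d\end{pmatrix}$, $B_1(q,p)=|Q_\infty q|^2+\frac{\gamma^2}{2}(1-\lambda)\langle Q_\infty q,q\rangle+\frac\gamma2\langle Q_\infty q,p\rangle-\left(\frac12|p|^2+\frac\gamma2\langle q,p\rangle+\frac12\langle(Q_\infty+\frac{\gamma^2}{2}(1-\lambda)I_d)q,q\rangle\right)$, $C_{B_1}=\nabla^2B_1$, $\mathsf{K}$ the unique symmetric solution of $B^\top\mathsf{K}+\mathsf{K}B=C_{B_1}$, with $d\times d$ blocks $\mathsf{K}_{qq},\mathsf{K}_{qp},\mathsf{K}_{pq},\mathsf{K}_{pp}$, and $\mathcal{M}(z)=\frac12z^\top\mathsf{K}z$. Constants: $a_{\min}=\lambda_{\min}(Q_\infty)+\frac{\gamma^2}{2}(1-\lambda)$,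 $a_{\max}=\lambda_{\max}(Q_\infty)+\frac{\gamma^2}{2}(1-\lambda)$, $\underline a=\frac14\left(a_{\min}+1-\sqrt{(a_{\min}-1)^2+\gamma^2}\right)$, $H=2(\|\mathsf{K}_{pq}\|_{\mathrm{op}}+\|\mathsf{K}_{pp}\|_{\mathrm{op}})+4\lambda_{\max}(Q_\infty)+\gamma^2|1-\lambda|+\gamma$, $\rho_\star=\frac12\left(-H+\sqrt{H^2+\frac54\underline a}\right)$; for $R\ge1$, $\rho_\nabla(R)=\sup_{|q|\ge R}\frac{|\nabla U(q)-Q_\infty q|}{|q|}$, $\delta_U(R)=\sup_{|q|\ge R}\frac{|U(q)-\frac12\langle Q_\infty q,q\rangle|}{1+|q|^2}$; $R_0=\inf\{R\ge\max\{1,C_{\mathrm{linear}}\}:\rho_\nabla(R)\le\rho_\star\}$; $$\underline c_{\mathrm{imp}}=\frac38\cdot\frac{a_{\min}+1-\sqrt{(a_{\min}-1)^2+\gamma^2}}{a_{\max}+1+\sqrt{(a_{\max}-1)^2+\gamma^2}+8\delta_U(R_0)},\quad C_{\mathrm{imp}}=\sup_{|q|\le R_0,\,p\in\mathbb{R}^d}\{\mathcal{A}_0\mathcal{M}+\mathcal{A}'\mathcal{V}_0+\underline c_{\mathrm{imp}}\mathcal{V}_0\}.$$ $\mu_{\min}=\frac18\left(\gamma^2(1-\lambda)+2-\sqrt{(\gamma^2(1-\lambda)-2)^2+4\gamma^2}\right)$, $c_1=\min(1,\mu_{\min})$, $C_{\mathcal{M}}=\frac12\|\mathsf{K}\|_{\mathrm{op}}$,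 $\widetilde C_{\mathcal{M}}=C_{\mathcal{M}}/c_1$, $C_1=C_{\mathrm{imp}}+\gamma\,\mathrm{tr}(\mathsf{K}_{pp})+dL+\frac{\gamma^2}{2}d|1-\lambda|$, $C_2=|\mathrm{tr}(\mathsf{K}_{qq})|+3C_{\mathcal{M}}\frac{L+|\nabla U(0)|}{c_1}$, $\delta=\underline c_{\mathrm{imp}}-\lambda\widetilde C_{\mathcal{M}}$, $C_\lambda=C_2+\widetilde C_{\mathcal{M}}\underline c_{\mathrm{imp}}$, $A'_\alpha=A+\frac\alpha\gamma[C_1+\alpha C_2+\widetilde C_{\mathcal{M}}(\lambda+\underline c_{\mathrm{imp}})]$, $\alpha_0=\frac{\gamma\lambda}{2}\left\{\frac1{c_1}\left[\frac{\gamma^4}{4}(1-\lambda)^2+\frac{\gamma^2}{4}\right]+Ld+\frac{\gamma^2}{2}d(1-\lambda)\right\}^{-1}$, $\alpha_1=\min\{\alpha_0,1,\frac{c_1}{2C_{\mathcal{M}}},\alpha_{\mathrm{pos}}\}$, where $\alpha_{\mathrm{pos}}>0$ is any constant with $\lambda+\delta\alpha-C_\lambda\alpha^2\ge\lambda/2$ on $(0,\alpha_{\mathrm{pos}}]$. Metric constant: $\theta_0=L\gamma^{-2}$ and $J_2=\frac{12}{5}(1+2\theta_0+2\theta_0^2)\frac{d+A}{\gamma^2(1-2\lambda)}$. *)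

(* Defs.v *)
From HB Require Import structures.
From mathcomp Require Import all_boot all_order all_algebra.
From mathcomp Require Import all_classical all_reals all_analysis.
Set Implicit Arguments.
Unset Strict Implicit.
Unset Printing Implicit Defensive.
Import Order.TTheory GRing.Theory Num.Theory numFieldNormedType.Exports.
Local Open Scope classical_set_scope.
Local Open Scope ring_scope.

(* MathComp-Analysis norms matrices by the maximum of the entries, so the
   Euclidean norm is defined here. *)
Section Euclidean.
Variable R : realType.

Definition dotv n (x y : 'cV[R]_n) : R := \sum_i x i 0 * y i 0.

Definition enorm n (x : 'cV[R]_n) : R := Num.sqrt (dotv x x).

Definition opnorm n (M : 'M[R]_n) : R :=
  sup [set enorm (M *m x) | x in [set x : 'cV[R]_n | enorm x <= 1]].

Definition sym_posdef n (M : 'M[R]_n) : Prop :=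
  M^T = M /\ forall x : 'cV[R]_n, x != 0 -> 0 < dotv (M *m x) x.

(* Used for symmetric matrices only, whose spectrum is real. *)
Definition lambda_min n (M : 'M[R]_n) : R := inf [set a | eigenvalue M a].
Definition lambda_max n (M : 'M[R]_n) : R := sup [set a | eigenvalue M a].

End Euclidean.

Section Calculus.
Variables (R : realType) (n : nat).
Implicit Types (f : 'cV[R]_n -> R) (z : 'cV[R]_n).

Definition basis_vec (i : 'I_n) : 'cV[R]_n := delta_mx i 0.

Definition partial (i : 'I_n) f z : R := 'D_(basis_vec i) f z.

Definition grad f z : 'cV[R]_n := \col_i partial i f z.

Definition hessian f z : 'M[R]_n := \matrix_(i, j) partial i (partial j f) z.

Definition C1 f : Prop := (forall z, differentiable f z) /\ continuous (grad f).

Definition C2 f : Prop := C1 f /\ forall i, C1 (partial i f).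

Definition C11loc f : Prop :=
  C1 f /\ [locally [lipschitz grad f z | z in [set: 'cV[R]_n]]].

(* The library has Lebesgue measure on the line only: a subset of R^n is
   Lebesgue-null iff it is covered by countably many boxes of arbitrarily small
   total volume. *)
Definition lebesgue_null (N : set 'cV[R]_n) : Prop :=
  forall eps : R, 0 < eps ->
  exists a b : nat -> 'cV[R]_n,
    [/\ forall k i, a k i 0 <= b k i 0,
        N `<=` \bigcup_k [set x | forall i, a k i 0 <= x i 0 <= b k i 0] &
        (\sum_(0 <= k <oo) (\prod_i (b k i 0 - a k i 0))%:E <= eps%:E)%E].

Definition lebesgue_ae (P : 'cV[R]_n -> Prop) : Prop :=
  lebesgue_null [set z | ~ P z].

End Calculus.

(* Phase-space points z = (q, p) are columns of height d + d:
   q = usubmx z and p = dsubmx z. *)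
Section HFHR.
Variables (R : realType) (d : nat).
Variable U : 'cV[R]_d -> R.
Variables gamma L A lam : R.
Implicit Types (phi V : 'cV[R]_(d + d) -> R) (z : 'cV[R]_(d + d)).
Implicit Types (alpha ell E : R) (q p : 'cV[R]_d).

Definition grad_q phi z : 'cV[R]_d := usubmx (grad phi z).
Definition grad_p phi z : 'cV[R]_d := dsubmx (grad phi z).

Definition laplacian_q phi z : R :=
  \sum_(i < d) partial (lshift d i) (partial (lshift d i) phi) z.
Definition laplacian_p phi z : R :=
  \sum_(i < d) partial (rshift d i) (partial (rshift d i) phi) z.

Definition opA0 phi z : R :=
  dotv (dsubmx z) (grad_q phi z)
  + dotv (- (gamma *: dsubmx z) - grad U (usubmx z)) (grad_p phi z).

Definition opA' phi z : R := dotv (- grad U (usubmx z)) (grad_q phi z).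

Definition generator alpha phi z : R :=
  dotv (dsubmx z - alpha *: grad U (usubmx z)) (grad_q phi z)
  + dotv (- (gamma *: dsubmx z) - grad U (usubmx z)) (grad_p phi z)
  + alpha * laplacian_q phi z + gamma * laplacian_p phi z.

Definition assumption1 : Prop :=
  [/\ [/\ 0 < L, 0 < A & 0 < lam <= 4^-1],
      C1 U /\ (forall q, 0 <= U q),
      (forall q q', enorm (grad U q - grad U q') <= L * enorm (q - q')) &
      (forall q, 2^-1 * dotv q (grad U q)
                 >= lam * (U q + gamma ^+ 2 / 4 * enorm q ^+ 2) - A)].

Definition V0 z : R :=
  let q := usubmx z in let p := dsubmx z in
  U q + gamma ^+ 2 / 4 * (enorm (q + gamma^-1 *: p) ^+ 2
                          + enorm (gamma^-1 *: p) ^+ 2 - lam * enorm q ^+ 2).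

(* By Rademacher's theorem the second derivatives occurring in the generator
   exist almost everywhere; this is made explicit because 'D_v f z is a junk
   value where the derivative does not exist. *)
Definition admissible alpha V ell E : Prop :=
  [/\ forall z, 0 <= V z,
      C2 V \/ C11loc V &
      lebesgue_ae (fun z =>
        (forall i, derivable (partial i V) z (basis_vec R i)) /\
        generator alpha V z <= gamma * (d%:R + E - ell * V z))].

Variable Q : 'M[R]_d.
Variable Clin : R.

Definition assumption2 : Prop :=
  [/\ 0 < Clin, sym_posdef Q &
      exists varrho : R -> R,
        [/\ forall r, 0 <= r -> 0 <= varrho r,
            forall r s, 0 <= r -> r <= s -> varrho s <= varrho r,
            varrho r @[r --> +oo] --> (0 : R) &
            forall q, Clin <= enorm q ->
              enorm (grad U q - Q *m q) <= varrho (enorm q) * enorm q]].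

Definition driftB : 'M[R]_(d + d) :=
  block_mx 0 1%:M (- Q) (- gamma%:M).

Definition polyB1 z : R :=
  let q := usubmx z in let p := dsubmx z in
  enorm (Q *m q) ^+ 2 + gamma ^+ 2 / 2 * (1 - lam) * dotv (Q *m q) q
  + gamma / 2 * dotv (Q *m q) p
  - (2^-1 * enorm p ^+ 2 + gamma / 2 * dotv q p
     + 2^-1 * dotv ((Q + (gamma ^+ 2 / 2 * (1 - lam))%:M) *m q) q).

(* polyB1 is a quadratic form, so its Hessian is the same at every point. *)
Definition CB1 : 'M[R]_(d + d) := hessian polyB1 0.

(* Under assumption2 and gamma > 0 the matrix driftB is Hurwitz, hence there is
   exactly one such K. *)
Definition lyapunov_solution (K : 'M[R]_(d + d)) : Prop :=
  K^T = K /\ driftB^T *m K + K *m driftB = CB1.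

Variable K : 'M[R]_(d + d).

Definition Kqq : 'M[R]_d := ulsubmx K.
Definition Kpq : 'M[R]_d := dlsubmx K.
Definition Kpp : 'M[R]_d := drsubmx K.

Definition corrM z : R := 2^-1 * dotv z (K *m z).

Definition Vcorr alpha z : R := V0 z + alpha * corrM z.

Definition a_min : R := lambda_min Q + gamma ^+ 2 / 2 * (1 - lam).
Definition a_max : R := lambda_max Q + gamma ^+ 2 / 2 * (1 - lam).

Definition a_low : R :=
  4^-1 * (a_min + 1 - Num.sqrt ((a_min - 1) ^+ 2 + gamma ^+ 2)).

Definition cstH : R :=
  2 * (opnorm Kpq + opnorm Kpp) + 4 * lambda_max Q
  + gamma ^+ 2 * `|1 - lam| + gamma.

Definition rho_star : R :=
  2^-1 * (- cstH + Num.sqrt (cstH ^+ 2 + 5 / 4 * a_low)).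

Definition rho_nabla (r : R) : R :=
  sup [set enorm (grad U q - Q *m q) / enorm q | q in [set q | r <= enorm q]].

Definition delta_U (r : R) : R :=
  sup [set `|U q - 2^-1 * dotv (Q *m q) q| / (1 + enorm q ^+ 2)
      | q in [set q | r <= enorm q]].

Definition R0 : R :=
  inf [set r | Num.max 1 Clin <= r /\ rho_nabla r <= rho_star].

Definition c_imp : R :=
  3 / 8 * ((a_min + 1 - Num.sqrt ((a_min - 1) ^+ 2 + gamma ^+ 2))
           / (a_max + 1 + Num.sqrt ((a_max - 1) ^+ 2 + gamma ^+ 2)
              + 8 * delta_U R0)).

Definition C_imp : R :=
  sup [set opA0 corrM z + opA' V0 z + c_imp * V0 z
      | z in [set z | enorm (usubmx z) <= R0]].

Definition mu_min : R :=
  8^-1 * (gamma ^+ 2 * (1 - lam) + 2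
          - Num.sqrt ((gamma ^+ 2 * (1 - lam) - 2) ^+ 2 + 4 * gamma ^+ 2)).

Definition c1 : R := Num.min 1 mu_min.

Definition C_M : R := 2^-1 * opnorm K.
Definition Ctilde_M : R := C_M / c1.

Definition cst1 : R :=
  C_imp + gamma * \tr Kpp + d%:R * L + gamma ^+ 2 / 2 * d%:R * `|1 - lam|.

Definition cst2 : R :=
  `|\tr Kqq| + 3 * C_M * ((L + enorm (grad U 0)) / c1).

Definition delta : R := c_imp - lam * Ctilde_M.

Definition C_lam : R := cst2 + Ctilde_M * c_imp.

Definition A'_ alpha : R :=
  A + alpha / gamma * (cst1 + alpha * cst2 + Ctilde_M * (lam + c_imp)).

Definition alpha0 : R :=
  gamma * lam / 2
  * (c1^-1 * (gamma ^+ 4 / 4 * (1 - lam) ^+ 2 + gamma ^+ 2 / 4)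
     + L * d%:R + gamma ^+ 2 / 2 * d%:R * (1 - lam))^-1.

Definition alpha_pos_spec (alpha_pos : R) : Prop :=
  0 < alpha_pos /\
  forall alpha, 0 < alpha <= alpha_pos ->
    lam / 2 <= lam + delta * alpha - C_lam * alpha ^+ 2.

Variable alpha_pos : R.

Definition alpha1 : R :=
  Num.min (Num.min alpha0 1) (Num.min (c1 / (2 * C_M)) alpha_pos).

Definition theta0 : R := L / gamma ^+ 2.

Definition J2 : R :=
  12 / 5 * (1 + 2 * theta0 + 2 * theta0 ^+ 2)
  * ((d%:R + A) / (gamma ^+ 2 * (1 - 2 * lam))).

Definition L_eff alpha : R := (1 + alpha * gamma) * L.

Definition Lambda alpha ell : R := J2 * ((1 + alpha * gamma) * L / ell).

Definition Lambda0 : R := Lambda 0 lam.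

Definition hfun (x : R) : R := Num.sqrt x * expR (- x).

Definition M_h : R :=
  sup [set `|(x ^+ 2 - x - 4^-1) / (x `^ (3 / 2)) * expR (- x)|
      | x in `[Lambda0 / 2, Lambda0]].

Definition Lambda2 alpha ell : R :=
  hfun (Lambda alpha ell) * (L_eff alpha / gamma ^+ 2).

Definition Lambda3 (kappa alpha ell : R) : R :=
  kappa * hfun (Lambda alpha ell).

Definition gapD : R := delta - gamma * lam.

Definition c_Lambda : R := 8^-1 * J2 * L * (gapD / lam ^+ 2).

Definition c3_star : R := 2^-1 * (1 - (2 * Lambda0)^-1) * c_Lambda.

Definition alpha_metric_acc : R :=
  let m :=
    Num.min (Num.min alpha1 1)
      (Num.min (4 * lam / gapD)
        (8 * lam ^+ 2 * Num.sqrt Lambda0 * expR (- Lambda0)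
           * (1 - (2 * Lambda0)^-1) / (J2 * L * gapD * M_h))) in
  if C_lam == 0 then m
  else Num.min m
         (Num.min (gapD / (4 * C_lam)) (Num.sqrt (lam / (2 * C_lam)))).

End HFHR.

(* Main.v *)
(* The profile h x = sqrt x * exp (- x) decreases on [1/2, +oo), so lowering Lambda
   below Lambda_0 raises h only as long as Lambda stays above 1/2.  The lower bound
   on the rates gives part (i) by algebra.  A Taylor expansion of h at Lambda_0,
   whose remainder is controlled by M_h, then gives (ii), provided that
   Lambda_alpha(lam_ alpha) >= 1/2, that is, provided that lam_ alpha is not too
   large.

   This last fact is where admissibility enters.  Divide the drift inequality at
   points z ~ n w by n^2 and let n tend to infinity: the inequality becomes
   homogeneous quadratic in w.  On the plane spanned by (v, 0) and (0, v), with
   Q v = m v, it says that a positive definite quadratic form decays at rate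
   gamma * ell under the flow of [[- alpha m, 1], [- m, - gamma]].  Trace and
   determinant bound that rate by 4 det / tr, whence
   ell <= 4 (L / gamma^2) (1 + alpha gamma) and Lambda_alpha(ell) >= 3/5.  The
   inequality is only assumed almost everywhere, so one also needs that a unit
   cube is not Lebesgue-null. *)
Require Import Defs.
From mathcomp Require Import all_boot all_order all_algebra.
From mathcomp Require Import all_classical all_reals all_analysis.
From mathcomp Require Import measurable_realfun complex ring lra.

Set Implicit Arguments.
Unset Strict Implicit.
Unset Printing Implicit Defensive.

Import Order.TTheory GRing.Theory Num.Theory numFieldNormedType.Exports.
Local Open Scope classical_set_scope.
Local Open Scope ring_scope.

(** * The profile function *)

Section Profile.
Variable R : realType.

Lemma derive_ge0_le (f df : R -> R) (a b : R) : a <= b ->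
  (forall x, x \in `[a, b] -> is_derive x 1 f (df x)) ->
  (forall x, x \in `[a, b] -> 0 <= df x) -> f a <= f b.
Proof.
move=> ab fd df0.
have fc : {within `[a, b], continuous f}.
  apply: derivable_within_continuous => x xab.
  exact: (@ex_derive _ _ _ _ _ _ _ (fd x xab)).
have fo x : x \in `]a, b[ -> is_derive x 1 f (df x).
  by move=> xab; apply: fd; apply: subset_itv_oo_cc.
have [c cab] := MVT_segment ab fo fc.
by rewrite -subr_ge0 => ->; rewrite mulr_ge0 ?df0// subr_ge0.
Qed.

(** [hfun1] and [hfun2] are the first two derivatives of [hfun] on the positive half-line; [hfun2]
    is the expression whose absolute value enters [M_h]. *)
Definition hfun1 (x : R) : R := expR (- x) * ((2 * Num.sqrt x)^-1 - Num.sqrt x).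

Definition hfun2 (x : R) : R :=
  (x ^+ 2 - x - 4^-1) / (x `^ (3 / 2)) * expR (- x).

Lemma is_derive_expRN (x : R) :
  is_derive x 1 (fun y => expR (- y)) (- expR (- x)).
Proof.
have h := @is_derive1_comp R expR -%R x _ _ (is_derive_expR (- x))
   (is_deriveN (is_derive_id x 1)).
by apply: (is_derive_eq h); rewrite mulrN1.
Qed.

Lemma powR32 (x : R) : 0 < x -> x `^ (3 / 2) = x * Num.sqrt x.
Proof.
move=> x0; rewrite (_ : 3 / 2 = 1 + 2^-1); last by field.
by rewrite powRD ?gt_eqF ?implybT// powRr1 ?ltW// powR12_sqrt ?ltW.
Qed.

Lemma is_derive_hfun (x : R) : 0 < x -> is_derive x 1 (@hfun R) (hfun1 x).
Proof.
move=> x0; have s0 : 0 < Num.sqrt x by rewrite sqrtr_gt0.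
have h := is_deriveM (is_derive1_sqrt x0) (is_derive_expRN x).
apply: (is_derive_eq h); rewrite /hfun1 /GRing.scale /=.
by field; rewrite gt_eqF.
Qed.

Lemma is_derive_hfun1 (x : R) : 0 < x -> is_derive x 1 hfun1 (hfun2 x).
Proof.
move=> x0; have s0 : 0 < Num.sqrt x by rewrite sqrtr_gt0.
have ss : 2 * Num.sqrt x != 0 by rewrite gt_eqF ?mulr_gt0.
have h2 := @is_deriveZ R R R Num.sqrt 2 x 1 _ (is_derive1_sqrt x0).
have h3 := @is_deriveV R _ x _ 1 ss h2.
have h4 := is_deriveB h3 (is_derive1_sqrt x0).
have h := is_deriveM (is_derive_expRN x) h4.
apply: (is_derive_eq h); rewrite /hfun2 powR32// /GRing.scale /=.
rewrite [X in _ + X * _](_ : _ = (2 * Num.sqrt x)^-1 - Num.sqrt x)//.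
rewrite /GRing.scale /=.
set e := expR _; rewrite -(sqr_sqrtr (ltW x0)) sqrtr_sqr ger0_norm ?ltW//.
by field; rewrite gt_eqF.
Qed.

Lemma hfun1_le0 (x : R) : 2^-1 <= x -> hfun1 x <= 0.
Proof.
move=> x2; have x0 : 0 < x by lra.
have s0 : 0 < Num.sqrt x by rewrite sqrtr_gt0.
rewrite /hfun1 pmulr_rle0 ?expR_gt0// subr_le0 -[leLHS]div1r.
rewrite ler_pdivrMr ?mulr_gt0// mulrCA -expr2 (sqr_sqrtr (ltW x0)); lra.
Qed.

Lemma hfun_nincr (x y : R) : 2^-1 <= x -> x <= y -> hfun y <= hfun x.
Proof.
move=> x2 xy; rewrite -lerN2.
apply: (@derive_ge0_le (fun z => - hfun z) (fun z => - hfun1 z)) => // z.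
- rewrite in_itv /= => /andP[xz _]; apply: is_deriveN.
  by apply: is_derive_hfun; lra.
- by rewrite in_itv /= => /andP[xz _]; rewrite oppr_ge0 hfun1_le0//; lra.
Qed.

(** Second-order Taylor bound by two monotonicity arguments. Since [hfun2] is at least - M,
    [hfun1 x + M * x] is nondecreasing; integrating the resulting bound on [hfun1] gives the
    claim. *)
Lemma hfun_taylor (l t M : R) : 0 < l -> 0 <= t <= l / 2 ->
  (forall x, l / 2 <= x <= l -> `|hfun2 x| <= M) ->
  hfun l - t * hfun1 l - M * t ^+ 2 / 2 <= hfun (l - t).
Proof.
move=> l0 /andP[t0 tl] hM.
have h1 x : l - t <= x <= l -> hfun1 x + M * x <= hfun1 l + M * l.
  move=> /andP[tx xl].
  apply: (@derive_ge0_le (fun z => hfun1 z + M * z) (fun z => hfun2 z + M * 1))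
      => // z; rewrite in_itv /= => /andP[xz zl].
  - have z0 : 0 < z by lra.
    have hz := @is_deriveZ R R R id M z 1 1 (is_derive_id z 1).
    have hh := is_deriveD (is_derive_hfun1 z0) hz.
    exact hh.
  - have : `|hfun2 z| <= M by apply: hM; apply/andP; split; lra.
    rewrite ler_norml => /andP[]; lra.
(* An antiderivative of hfun1 l + M (l - y) - hfun1 y, which [h1] shows to be nonnegative. The
   polynomial part is differentiated through [{poly R}]. *)
pose G (y : R) := hfun1 l * y + M * (l * y - y ^+ 2 / 2) - hfun y.
suff : G (l - t) <= G l by rewrite /G; lra.
apply: (@derive_ge0_le G (fun y => hfun1 l + M * (l - y) - hfun1 y)) => [|y|y].
- by lra.
- rewrite in_itv /= => /andP[ty yl]; apply: is_deriveB; last first.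
    by apply: is_derive_hfun; lra.
  pose p : {poly R} := hfun1 l *: 'X + M *: (l *: 'X - 2^-1 *: 'X^2).
  have hp := is_derive_poly p y.
  rewrite (_ : horner p = fun z => hfun1 l * z + M * (l * z - z ^+ 2 / 2)) in hp.
    apply: (is_derive_eq hp).
    by rewrite /p derivD !derivZ derivB !derivZ derivX derivXn !hornerE /=; field.
  by apply: funext => z; rewrite /p !hornerE /=; field.
- rewrite in_itv /= => yy; have := h1 y yy; lra.
Qed.

Lemma hfun2_le_sup (l x : R) : 0 < l -> l / 2 <= x <= l ->
  `|hfun2 x| <= sup [set `|(y ^+ 2 - y - 4^-1) / (y `^ (3 / 2)) * expR (- y)|
                    | y in `[l / 2, l]].
Proof.
move=> l0 xl; apply: ub_le_sup; last by exists x => //=; rewrite in_itv.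
(* The supremum dominates its members only if the set is bounded above. On [l/2, l] the numerator is
   bounded by its largest possible value, the power from below by its value at l/2, and the
   exponential by 1. *)
exists ((l ^+ 2 + l + 4^-1) / (l / 2 * Num.sqrt (l / 2))) => _ [y /= + <-].
rewrite in_itv /= => /andP[ly yl]; have y0 : 0 < y by lra.
rewrite powR32// !normrM -[leRHS]mulr1.
apply: ler_pM => //.
  apply: ler_pM => //; first by rewrite ler_norml; apply/andP; split; nra.
  have s0 : 0 < Num.sqrt (l / 2) by rewrite sqrtr_gt0; lra.
  have s1 : Num.sqrt (l / 2) <= Num.sqrt y by rewrite ler_wsqrtr.
  rewrite normfV ger0_norm; last by rewrite mulr_ge0 ?sqrtr_ge0 ?ltW.
  rewrite lef_pV2 ?posrE ?mulr_gt0 ?sqrtr_gt0//; last lra.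
  by apply: ler_pM => //; lra.
by rewrite ger0_norm ?expR_ge0// -expR0 ler_expR; lra.
Qed.
End Profile.

(** * Unit cubes are not null *)

Section Boxes.
Variable R : realType.
Local Notation mu := (@lebesgue_measure R).

Lemma indicR_ge0 (T : Type) (E : set T) (x : T) : 0 <= \1_E x :> R.
Proof. by rewrite indicE ler0n. Qed.

(* Induction on the dimension: the boxes whose last side contains y cover the
   slice at height y, and integrating in y restores the last factor of the
   volumes. *)
Lemma cube_cover_volume (c : nat -> R) (a b : nat -> nat -> R) (n : nat) :
  (forall k i, a k i <= b k i) ->
  forall S : set nat,
  (forall x : nat -> R, (forall i, (i < n)%N -> c i <= x i <= c i + 1) ->
     exists2 k, S k & forall i, (i < n)%N -> a k i <= x i <= b k i) ->
  (1 <= \sum_(0 <= k <oo)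
     (\1_S k * \prod_(i < n) (b k i - a k i))%:E)%E.
Proof.
move=> ab; elim: n => [|n IH] S cov.
  (* In dimension 0 the volumes are empty products, so a single index in [S] already contributes
     1. *)
  have [//|k Sk _] := cov c.
  apply: (@le_trans _ _ (\sum_(0 <= j < k.+1)
     (\1_S j * \prod_(i < 0) (b j i - a j i))%:E)%E); last first.
    apply: nneseries_lim_ge => j _ _; rewrite lee_fin big_ord0 mulr1.
    exact: indicR_ge0.
  rewrite big_nat_recr//= big_ord0 mulr1 indicE mem_set//= leeDr//.
  by apply: sume_ge0 => j _; rewrite lee_fin big_ord0 mulr1; exact: indicR_ge0.
have vol0 m k : 0 <= \prod_(i < m) (b k i - a k i).
  by apply: prodr_ge0 => i _; rewrite subr_ge0.
pose D : set (measurableTypeR R) := `[c n, c n + 1]%classic.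
pose f k (y : measurableTypeR R) : \bar R :=
  (\1_`[a k n, b k n]%classic y * (\1_S k * \prod_(i < n) (b k i - a k i)))%:E.
have f0 k y : (0 <= f k y)%E.
  by rewrite lee_fin !mulr_ge0// ?indicR_ge0.
have mf k : measurable_fun D (f k).
  apply/measurable_EFinP; exact: measurable_funM.
have slice y : D y -> (1 <= \sum_(0 <= k <oo) f k y)%E.
  rewrite /D /= in_itv /= => Dy.
  (* The set [S] of allowed indices is carried through the induction for this restriction to the
     boxes that meet height y. *)
  have := IH (S `&` [set k | a k n <= y <= b k n]).
  move=> /(_ _)/le_trans; apply.
    move=> x xc; have [|k Sk kx] := cov (fun i => if i == n then y else x i).
      move=> i; rewrite ltnS leq_eqVlt; case: eqP => [->//|_ /= ].
      exact: xc.
    exists k; first by split=> //=; have := kx n (ltnSn n); rewrite eqxx.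
    by move=> i ilt; have := kx i (ltnW ilt); rewrite ltn_eqF.
  apply: lee_nneseries => k _ //=.
    move=> _; rewrite lee_fin. apply: mulr_ge0. exact: indicR_ge0. exact: vol0.
  rewrite lee_fin !indicE in_setI -mulnb natrM mulrA [_%:R * _ in leRHS]mulrC.
  have -> : (k \in [set k | a k n <= y <= b k n]) = (y \in `[a k n, b k n]%classic).
    by apply/idP/idP => /set_mem/= h; apply: mem_set; move: h => /=; rewrite in_itv.
  exact: lexx.
have mD : measurable D by exact: measurable_itv.
have muD : mu D = 1%E.
  rewrite lebesgue_measure_itv /= lte_fin ltrDl ltr01.
  by rewrite -EFinB addrAC subrr add0r.
(* Integrate the slice inequality over a unit interval, then exchange sum and integral, all terms
   being nonnegative. *)
have : (\int[mu]_(y in D) cst 1 y <= \int[mu]_(y in D) \sum_(0 <= k <oo) f k y)%E.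
  by apply: ge0_le_integral => //; exact: ge0_emeasurable_sum.
rewrite integral_cst//. rewrite [X in (1 * X)%E]muD mul1e integral_nneseries//.
move=> /le_trans; apply; apply: lee_nneseries => k _.
  by move=> _; apply: integral_ge0 => y _; exact: f0.
rewrite /f; under eq_integral do rewrite mulrC EFinM.
rewrite ge0_integralZl//; first last.
- by rewrite lee_fin mulr_ge0 ?indicR_ge0.
- by apply/measurable_EFinP; apply: measurable_indic.
rewrite integral_indic// big_ord_recr /= mulrA [in leRHS]EFinM.
apply: lee_pmul => //.
  by rewrite lee_fin; apply: mulr_ge0; [exact: indicR_ge0|exact: vol0].
apply: (@le_trans _ _ (mu `[a k n, b k n]%classic)).
  by apply: le_measure; rewrite ?inE//; apply: measurableI.
rewrite lebesgue_measure_itv /= lte_fin; case: ltP => [_|_].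
  by rewrite EFinB.
by rewrite lee_fin subr_ge0.
Qed.
End Boxes.

(** Otherwise the null set contains the whole unit cube, which is then covered by boxes of total
    volume at most 1/2. *)
Lemma null_avoids_cube (R : realType) (n : nat) (N : set 'cV[R]_n) (c : 'cV[R]_n) :
  lebesgue_null N ->
  exists2 z : 'cV[R]_n, ~ N z & forall i, c i 0 <= z i 0 <= c i 0 + 1.
Proof.
move=> /(_ 2^-1 _)[|a [b [ab cov vol]]]; first by rewrite invr_gt0.
apply: contrapT => H.
(* Padding by zero turns vectors into the sequences used by [cube_cover_volume]; only indices below
   n matter. *)
pose ext (x : 'cV[R]_n) (i : nat) : R :=
  if insub i is Some j then x j 0 else 0.
have extE x (i : 'I_n) : ext x i = x i 0 by rewrite /ext valK.
have ab' k i : ext (a k) i <= ext (b k) i by rewrite /ext; case: insub.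
have := @cube_cover_volume R (ext c) (fun k => ext (a k)) (fun k => ext (b k))
  n ab' setT.
rewrite leNgt => /(_ _)/negP; apply.
  move=> x xc; pose z : 'cV[R]_n := \col_i x i.
  have Nz : N z.
    apply: contrapT => Nz; apply: H; exists z => // i.
    by have := xc i (ltn_ord i); rewrite extE mxE.
  have [k _ /= kz] := cov _ Nz; exists k => // i ilt.
  have := kz (Ordinal ilt); rewrite mxE /=.
  by rewrite -!extE.
apply: (@le_lt_trans _ _ 2^-1%:E); last by rewrite lte_fin invf_lt1 ?ltr1n.
apply: le_trans vol; rewrite le_eqVlt; apply/orP; left; apply/eqP.
apply: eq_eseriesr => k _; rewrite indicE mem_setT mul1r.
by congr (_%:E); apply: eq_bigr => i _; rewrite !extE.
Qed.

(** * Euclidean norms and symmetric eigenvectors *)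

Section Euclid.
Variable R : realType.
Implicit Types n : nat.

Lemma dotvE n (x y : 'cV[R]_n) : dotv x y = (x^T *m y) 0 0.
Proof. by rewrite mxE; apply: eq_bigr => i _; rewrite mxE. Qed.

Lemma dotvC n (x y : 'cV[R]_n) : dotv x y = dotv y x.
Proof. by apply: eq_bigr => i _; rewrite mulrC. Qed.

Lemma dotvDr n (x y z : 'cV[R]_n) : dotv x (y + z) = dotv x y + dotv x z.
Proof. by rewrite !dotvE mulmxDr mxE. Qed.

Lemma dotvDl n (x y z : 'cV[R]_n) : dotv (y + z) x = dotv y x + dotv z x.
Proof. by rewrite ![dotv _ x]dotvC dotvDr. Qed.

Lemma dotvZr n a (x y : 'cV[R]_n) : dotv x (a *: y) = a * dotv x y.
Proof. by rewrite !dotvE -scalemxAr mxE. Qed.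

Lemma dotvZl n a (x y : 'cV[R]_n) : dotv (a *: x) y = a * dotv x y.
Proof. by rewrite dotvC dotvZr dotvC. Qed.

Lemma dotvNr n (x y : 'cV[R]_n) : dotv x (- y) = - dotv x y.
Proof. by rewrite !dotvE mulmxN mxE. Qed.

Lemma dotvNl n (x y : 'cV[R]_n) : dotv (- x) y = - dotv x y.
Proof. by rewrite dotvC dotvNr dotvC. Qed.

Lemma dotv_mulmxr n m (x : 'cV[R]_n) (M : 'M[R]_(n, m)) (y : 'cV[R]_m) :
  dotv x (M *m y) = dotv (M^T *m x) y.
Proof. by rewrite !dotvE trmx_mul trmxK mulmxA. Qed.

Lemma dotv_ge0 n (x : 'cV[R]_n) : 0 <= dotv x x.
Proof. by apply: sumr_ge0 => i _; rewrite -expr2 sqr_ge0. Qed.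

Lemma dotv_eq0 n (x : 'cV[R]_n) : dotv x x = 0 -> x = 0.
Proof.
move=> /eqP; rewrite psumr_eq0 => [/allP h|i _]; last by rewrite -expr2 sqr_ge0.
apply/colP => i; rewrite mxE.
by have := h i; rewrite mem_index_enum -expr2 sqrf_eq0 => /(_ isT)/eqP.
Qed.

Lemma enorm_ge0 n (x : 'cV[R]_n) : 0 <= enorm x.
Proof. exact: sqrtr_ge0. Qed.

Lemma enorm_sqr n (x : 'cV[R]_n) : enorm x ^+ 2 = dotv x x.
Proof. by rewrite sqr_sqrtr ?dotv_ge0. Qed.

Lemma dotv_cs_sqr n (x y : 'cV[R]_n) : dotv x y ^+ 2 <= dotv x x * dotv y y.
Proof.
have [y0|y0] := eqVneq (dotv y y) 0.
  have -> : y = 0 by exact: dotv_eq0.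
  by rewrite -(scale0r 0) !dotvZr !mul0r mulr0 expr0n.
have yp : 0 < dotv y y by rewrite lt_def y0 dotv_ge0.
have := dotv_ge0 (dotv y y *: x - dotv x y *: y).
rewrite !(dotvDl, dotvDr, dotvNl, dotvNr, dotvZl, dotvZr) (dotvC y x) => h.
rewrite -subr_ge0 -(pmulr_rge0 _ yp); apply: le_trans h _.
by rewrite le_eqVlt; apply/orP; left; apply/eqP; ring.
Qed.

Lemma dotv_cs n (x y : 'cV[R]_n) : `|dotv x y| <= enorm x * enorm y.
Proof.
rewrite -(@ler_pXn2r _ 2) ?nnegrE ?mulr_ge0 ?enorm_ge0//.
by rewrite real_normK ?num_real// exprMn !enorm_sqr dotv_cs_sqr.
Qed.

Lemma enormD n (x y : 'cV[R]_n) : enorm (x + y) <= enorm x + enorm y.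
Proof.
rewrite -(@ler_pXn2r _ 2) ?nnegrE ?addr_ge0 ?enorm_ge0//.
rewrite sqrrD !enorm_sqr !(dotvDl, dotvDr) (dotvC y x).
by have := dotv_cs x y; rewrite ler_norml => /andP[]; lra.
Qed.

Lemma enormZ n a (x : 'cV[R]_n) : enorm (a *: x) = `|a| * enorm x.
Proof.
by rewrite /enorm dotvZl dotvZr mulrA -expr2 sqrtrM ?sqr_ge0// sqrtr_sqr.
Qed.

Lemma enormN n (x : 'cV[R]_n) : enorm (- x) = enorm x.
Proof. by rewrite -scaleN1r enormZ normrN1 mul1r. Qed.

Lemma enorm0 n : enorm (0 : 'cV[R]_n) = 0.
Proof. by rewrite -(scale0r 0) enormZ normr0 mul0r. Qed.

Lemma coord_le_enorm n (x : 'cV[R]_n) i : `|x i 0| <= enorm x.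
Proof.
rewrite -(@ler_pXn2r _ 2) ?nnegrE ?enorm_ge0// enorm_sqr real_normK ?num_real//.
rewrite /dotv (bigD1 i)//= -expr2 lerDl; apply: sumr_ge0 => j _.
by rewrite -expr2 sqr_ge0.
Qed.

Lemma enorm_le_sum n (x : 'cV[R]_n) : enorm x <= \sum_i `|x i 0|.
Proof.
rewrite -(@ler_pXn2r _ 2) ?nnegrE ?enorm_ge0 ?sumr_ge0// enorm_sqr expr2.
rewrite mulr_suml; apply: ler_sum => i _.
rewrite -expr2 -real_normK ?num_real// expr2 ler_wpM2l//.
by rewrite (bigD1 i)//= lerDl sumr_ge0.
Qed.

(** This crude bound serves only to show that the supremum defining [opnorm] is taken over a bounded
    set. *)
Lemma enorm_mulmx_bounded n (M : 'M[R]_n) :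
  exists2 C, 0 <= C & forall x : 'cV[R]_n, enorm (M *m x) <= C * enorm x.
Proof.
exists (\sum_i \sum_j `|M i j|) => [|x].
  by apply: sumr_ge0 => i _; apply: sumr_ge0.
apply: (le_trans (enorm_le_sum _)); rewrite mulr_suml; apply: ler_sum => i _.
rewrite mxE mulr_suml; apply: (le_trans (ler_norm_sum _ _ _)).
by apply: ler_sum => j _; rewrite normrM ler_wpM2l// coord_le_enorm.
Qed.

Lemma opnorm_ubound n (M : 'M[R]_n) (x : 'cV[R]_n) :
  enorm x <= 1 -> enorm (M *m x) <= opnorm M.
Proof.
move=> x1; apply: ub_le_sup; last by exists x.
have [C C0 hC] := enorm_mulmx_bounded M; exists C => _ [y /= y1 <-].
by apply: (le_trans (hC y)); rewrite -[leRHS]mulr1 ler_wpM2l.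
Qed.

Lemma opnorm_ge0 n (M : 'M[R]_n) : 0 <= opnorm M.
Proof.
by apply: le_trans (@opnorm_ubound _ M 0 _); rewrite ?enorm_ge0 ?enorm0 ?ler01.
Qed.

Lemma enorm_mulmx n (M : 'M[R]_n) (x : 'cV[R]_n) :
  enorm (M *m x) <= opnorm M * enorm x.
Proof.
have [x0|x0] := eqVneq (enorm x) 0.
  have -> : x = 0 by apply: dotv_eq0; rewrite -enorm_sqr x0 expr0n.
  by rewrite mulmx0 enorm0 mulr0.
have xp : 0 < enorm x by rewrite lt_def x0 enorm_ge0.
rewrite -ler_pdivrMr// mulrC -[X in X * _]ger0_norm ?invr_ge0 ?enorm_ge0//.
rewrite -enormZ scalemxAr; apply: opnorm_ubound.
by rewrite enormZ ger0_norm ?invr_ge0 ?enorm_ge0// mulVf.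
Qed.

Lemma dotv_mulmx_le n (M : 'M[R]_n) (x : 'cV[R]_n) :
  `|dotv x (M *m x)| <= opnorm M * dotv x x.
Proof.
apply: (le_trans (dotv_cs _ _)); rewrite -enorm_sqr expr2 mulrA [leRHS]mulrC.
by rewrite ler_wpM2l ?enorm_ge0// enorm_mulmx.
Qed.
End Euclid.

Section SymEigen.
Variable R : realType.
Import complex.

Lemma mul_Re_real (z : R[i]%C) (a : R) : Re (z * real_complex R a) = Re z * a.
Proof. by case: z => x y /=; rewrite mulr0 subr0. Qed.

Lemma mul_Im_real (z : R[i]%C) (a : R) : Im (z * real_complex R a) = Im z * a.
Proof. by case: z => x y /=; rewrite mulr0 add0r. Qed.

(** The characteristic polynomial has a complex root l, with eigenvector u + i t. Pairing Q u with t
    and using symmetry gives Im l (|u|^2 + |t|^2) = 0, so l is real and u or t is a real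
    eigenvector. *)
Lemma sym_eigenvector (d : nat) (Q : 'M[R]_d) : (0 < d)%N -> Q^T = Q ->
  exists (m : R) (v : 'cV[R]_d), v != 0 /\ Q *m v = m *: v.
Proof.
case: d Q => // d Q _ Qs.
have : size (char_poly (map_mx (real_complex R) Q)) != 1%N by rewrite size_char_poly.
case/closed_rootP => l; rewrite -eigenvalue_root_char => /eigenvalueP[w wQ w0].
pose u := map_mx (@Re R) w; pose t := map_mx (@Im R) w.
have reE j : (u *m Q) 0 j = Re (l * w 0 j).
  have := congr1 (fun A : 'rV_d.+1 => Re (A 0 j)) wQ; rewrite !mxE => <-.
  rewrite raddf_sum; apply: eq_bigr => k _.
  by rewrite !mxE -mul_Re_real.
have imE j : (t *m Q) 0 j = Im (l * w 0 j).
  have := congr1 (fun A : 'rV_d.+1 => Im (A 0 j)) wQ; rewrite !mxE => <-.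
  rewrite raddf_sum; apply: eq_bigr => k _.
  by rewrite !mxE -mul_Im_real.
(* [eigenvalueP] yields a row eigenvector; by symmetry its transpose is a column eigenvector. *)
pose u' := u^T; pose t' := t^T.
have uQ : Q *m u' = Re l *: u' - Im l *: t'.
  apply/colP => j; rewrite -[Q]trmxK Qs -trmx_mul mxE reE !mxE.
  by case: l (w 0 j) {wQ reE imE} => a b [x y].
have tQ : Q *m t' = Im l *: u' + Re l *: t'.
  apply/colP => j; rewrite -[Q]trmxK Qs -trmx_mul mxE imE !mxE.
  by case: l (w 0 j) {wQ reE imE uQ} => a b [x y] /=; rewrite addrC.
have := dotv_mulmxr t' Q u'; rewrite Qs uQ tQ !(dotvDl, dotvDr, dotvNr, dotvZr, dotvZl).
rewrite (dotvC t' u') [RHS]addrC => /addrI eb.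
have t0 := dotv_ge0 t'; have u0 := dotv_ge0 u'.
have {eb} b0 : Im l * (dotv u' u' + dotv t' t') = 0 by lra.
have [u1|u1] := eqVneq u' 0; last first.
  exists (Re l), u'; split => //.
  have uu : dotv u' u' != 0 by apply: contra_neq u1; exact: dotv_eq0.
  move/eqP: b0; rewrite mulf_eq0 (gt_eqF (_ : 0 < _ + _)) ?orbF.
    by move=> /eqP l0; rewrite uQ l0 scale0r subr0.
  by rewrite ltr_wpDr// lt_def uu.
have [t1|t1] := eqVneq t' 0; last first.
  exists (Re l), t'; split => //.
  by rewrite tQ u1 scaler0 add0r.
case/eqP: w0; apply/rowP => j; rewrite mxE.
have := congr1 (fun A : 'cV_d.+1 => A j 0) u1.
have := congr1 (fun A : 'cV_d.+1 => A j 0) t1.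
by rewrite !mxE; case: (w 0 j) => x y /= -> ->.
Qed.
End SymEigen.

(** * Derivatives of a potential plus a quadratic form *)

Section Blocks.
Variables (R : realType) (d : nat).

Lemma dotv_block (x y : 'cV[R]_(d + d)) :
  dotv x y = dotv (usubmx x) (usubmx y) + dotv (dsubmx x) (dsubmx y).
Proof.
by rewrite /dotv big_split_ord; congr (_ + _); apply: eq_bigr => i _; rewrite !mxE.
Qed.

Lemma dotv_delta n (i : 'I_n) (y : 'cV[R]_n) : dotv (delta_mx i 0) y = y i 0.
Proof.
rewrite /dotv (bigD1 i)//= big1 ?addr0 ?mxE ?eqxx ?mul1r// => j ji.
by rewrite mxE (negbTE ji) mul0r.
Qed.

Lemma usubmx_delta_l (i : 'I_d) :
  usubmx (delta_mx (lshift d i) 0 : 'cV[R]_(d + d)) = delta_mx i 0.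
Proof. by apply/colP => j; rewrite !mxE eq_lshift. Qed.

Lemma usubmx_delta_r (i : 'I_d) :
  usubmx (delta_mx (rshift d i) 0 : 'cV[R]_(d + d)) = 0.
Proof. by apply/colP => j; rewrite !mxE eq_lrshift. Qed.
End Blocks.

Section Directional.
Variables (R : realType) (n : nat).

Lemma is_derive_of_cvg (f : 'cV[R]_n -> R) z v l :
  h^-1 *: (f (h *: v + z) - f z) @[h --> (0 : R)^'] --> l -> is_derive z v f l.
Proof. by move=> fl; split; [apply: cvgP fl|exact: cvg_lim fl]. Qed.

Lemma is_derive_quad (G : 'M[R]_n) z v : G^T = G ->
  is_derive z v (fun x => 2^-1 * dotv x (G *m x)) (dotv v (G *m z)).
Proof.
move=> Gs; apply: is_derive_of_cvg.
have h0 : (fun h : R => dotv v (G *m z) + h * (2^-1 * dotv v (G *m v))) @ 0^'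
    --> dotv v (G *m z).
  rewrite -[X in _ --> X]addr0 -[X in _ --> _ + X](mul0r (2^-1 * dotv v (G *m v))).
  apply: cvgD; first exact: cvg_cst.
  apply: cvgM; last exact: cvg_cst.
  exact: cvg_within.
apply: cvg_trans h0; apply: near_eq_cvg; near=> h.
have hn0 : h != 0 by near: h; exact: nbhs_dnbhs_neq.
rewrite /GRing.scale /= mulmxDr -scalemxAr !(dotvDl, dotvDr, dotvZl, dotvZr).
rewrite (dotv_mulmxr z G v) Gs (dotvC (G *m z) v).
by field.
Unshelve. all: by end_near. Qed.

(** Moving along a momentum axis leaves q fixed, so the potential is then differentiated in the
    direction 0. *)
Lemma derive_dir0 (f : 'cV[R]_n -> R) z : is_derive z 0 f 0.
Proof.
apply: is_derive_of_cvg.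
rewrite (_ : (fun _ => _) = cst 0); first exact: cvg_cst.
by apply/funext => h; rewrite scaler0 add0r subrr scaler0.
Qed.
End Directional.

Section Potential.
Variables (R : realType) (d : nat) (U : 'cV[R]_d -> R) (G : 'M[R]_(d + d)).
Hypothesis dU : forall q, differentiable U q.
Hypothesis Gs : G^T = G.

(** The common shape of [V0] and [Vcorr], which differ only in the matrix [G]. *)
Definition potquad (z : 'cV[R]_(d + d)) : R :=
  U (usubmx z) + 2^-1 * dotv z (G *m z).

Lemma is_derive_potquad z v :
  is_derive z v potquad ('D_(usubmx v) U (usubmx z) + dotv v (G *m z)).
Proof.
apply: is_deriveD; last exact: is_derive_quad.
have /derivableP[] := @diff_derivable _ _ _ U _ (usubmx v) (dU (usubmx z)).
move=> Ud _; apply: is_derive_of_cvg.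
rewrite (_ : (fun _ => _) = (fun h : R => h^-1 *:
    (U (h *: usubmx v + usubmx z) - U (usubmx z)))) //.
apply/funext => h; congr (_ *: (U _ - _)).
by apply/colP => k; rewrite !mxE.
Qed.

Lemma partial_potquad_l (i : 'I_d) z :
  partial (lshift d i) potquad z = partial i U (usubmx z) + (G *m z) (lshift d i) 0.
Proof.
have := is_derive_potquad z (basis_vec R (lshift d i)) => -[_].
by rewrite /partial /basis_vec => ->; rewrite usubmx_delta_l dotv_delta.
Qed.

Lemma partial_potquad_r (i : 'I_d) z :
  partial (rshift d i) potquad z = (G *m z) (rshift d i) 0.
Proof.
have := is_derive_potquad z (basis_vec R (rshift d i)) => -[_].
rewrite /partial /basis_vec => ->; rewrite usubmx_delta_r dotv_delta.
by have [_ ->] := derive_dir0 U (usubmx z); rewrite add0r.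
Qed.

Lemma grad_q_potquad z : grad_q potquad z = grad U (usubmx z) + usubmx (G *m z).
Proof. by apply/colP => i; rewrite !mxE partial_potquad_l mxE. Qed.

Lemma grad_p_potquad z : grad_p potquad z = dsubmx (G *m z).
Proof. by apply/colP => i; rewrite !mxE partial_potquad_r mxE. Qed.

Variable L : R.
Hypothesis L0 : 0 <= L.
Hypothesis UL : forall q q', enorm (grad U q - grad U q') <= L * enorm (q - q').

Lemma partial_potquad_lipschitz j z (h : R) :
  `|partial j potquad (h *: basis_vec R j + z) - partial j potquad z|
    <= (L + `|G j j|) * `|h|.
Proof.
have quad k : (G *m (h *: basis_vec R k + z)) k 0 - (G *m z) k 0 = h * G k k.
  by rewrite mulmxDr -scalemxAr -colE !mxE addrK.
rewrite mulrDl -(splitK j) /=; case: (fintype.split j) => i /=; last first.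
  rewrite !partial_potquad_r quad normrM [`|h| * _]mulrC lerDr.
  exact: mulr_ge0.
rewrite !partial_potquad_l opprD addrACA quad.
apply: (le_trans (ler_normD _ _)); rewrite normrM [`|h| * _]mulrC lerD2r.
set q := usubmx z; have -> : usubmx (h *: basis_vec R (lshift d i) + z) =
    h *: basis_vec R i + q.
  rewrite /basis_vec -(usubmx_delta_l R i).
  by apply/colP => k; rewrite !mxE.
have := coord_le_enorm (grad U (h *: basis_vec R i + q) - grad U q) i.
rewrite !mxE => /le_trans; apply; apply: (le_trans (UL _ _)).
rewrite addrK enormZ /enorm dotv_delta !mxE !eqxx sqrtr1.
by rewrite mulr1.
Qed.

(** By [partial_potquad_lipschitz] every difference quotient of the j-th partial derivative is
    bounded by L + |G j j|; the bound passes to the limit wherever the limit exists. *)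
Lemma partial2_potquad_ge j z :
  derivable (partial j potquad) z (basis_vec R j) ->
  - (L + `|G j j|) <= partial j (partial j potquad) z.
Proof.
move=> dj; apply: limr_ge; first exact: dj.
near=> h.
have hn0 : h != 0 by near: h; exact: nbhs_dnbhs_neq.
have := partial_potquad_lipschitz j z h.
set D := _ - _ => Dh.
have : `|h^-1 *: D| <= L + `|G j j|.
  rewrite normrM normfV mulrC ler_pdivrMr ?normr_gt0//.
by rewrite ler_norml => /andP[].
Unshelve. all: by end_near. Qed.

(** The first-order part of the generator applied to [potquad], with the gradient of U replaced by a
    free vector [g], so that it can later be exchanged for its linear asymptote. *)
Definition potdrift (gamma alpha : R) (g : 'cV[R]_d) (z : 'cV[R]_(d + d)) : R :=
  dotv (dsubmx z - alpha *: g) (g + usubmx (G *m z))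
  + dotv (- (gamma *: dsubmx z) - g) (dsubmx (G *m z)).

(** The Laplacians are bounded below uniformly in z, so they become negligible after division by the
    square of a large scale. *)
Lemma generator_potquad_ge gamma alpha : 0 <= gamma -> 0 <= alpha ->
  exists C : R, forall z,
    (forall j, derivable (partial j potquad) z (basis_vec R j)) ->
    potdrift gamma alpha (grad U (usubmx z)) z - C
      <= generator U gamma alpha potquad z.
Proof.
move=> g0 a0.
exists (alpha * (\sum_(i < d) (L + `|G (lshift d i) (lshift d i)|))
      + gamma * (\sum_(i < d) (L + `|G (rshift d i) (rshift d i)|))) => z dz.
rewrite /generator grad_q_potquad grad_p_potquad -/(potdrift _ _ _ _).
rewrite opprD -!mulrN -!sumrN addrA.
apply: lerD; [apply: lerD => //|]; apply: ler_wpM2l => //;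
  apply: ler_sum => i _; exact: partial2_potquad_ge.
Qed.

(** The almost-everywhere drift inequality holds at some point of every unit cube, with one constant
    for all cubes. *)
Lemma admissible_potdrift gamma alpha ell E : 0 <= gamma -> 0 <= alpha ->
  admissible U gamma alpha potquad ell E ->
  exists C : R, forall c : 'cV[R]_(d + d),
    exists2 z : 'cV[R]_(d + d), (forall i, c i 0 <= z i 0 <= c i 0 + 1) &
      potdrift gamma alpha (grad U (usubmx z)) z + gamma * ell * potquad z <= C.
Proof.
move=> g0 a0 [_ _ ae]; have [C hC] := generator_potquad_ge g0 a0.
exists (gamma * (d%:R + E) + C) => c.
have [z /contrapT[dz gz] cz] := null_avoids_cube c ae; exists z => //.
have := hC z dz; lra.
Qed.
End Potential.

(** * Quadratic asymptotics of the potential *)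

Section Asymptotics.
Variables (R : realType) (d : nat) (U : 'cV[R]_d -> R) (Q : 'M[R]_d) (L : R).
Hypothesis dU : forall q, differentiable U q.
Hypothesis UL : forall q q', enorm (grad U q - grad U q') <= L * enorm (q - q').
Hypothesis L0 : 0 <= L.

(** The error of the linear approximation is o(|q|) at infinity; the additive constant makes the
    bound valid at every q. *)
Definition grad_sublinear : Prop := forall eps, 0 < eps -> exists2 C, 0 <= C &
  forall q, enorm (grad U q - Q *m q) <= eps * enorm q + C.

Lemma assumption2_grad_sublinear (Clin : R) : assumption2 U Q Clin -> grad_sublinear.
Proof.
case=> Cl0 _ [rho [rho0 rhoD rho_lim Hrho]] eps eps0.
have : \forall r \near +oo, rho r < eps by exact: cvgr_lt rho_lim _ _.
case=> r0 [_ hr0]; pose M := Num.max Clin (r0 + 1).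
have M0 : 0 <= M by rewrite le_max ltW.
(* Beyond radius [M] the function [rho] is below [eps]; inside, the Lipschitz bound on the gradient
   and the operator norm of Q give this constant. *)
exists (L * M + enorm (grad U 0) + opnorm Q * M).
  by rewrite !addr_ge0 ?mulr_ge0 ?enorm_ge0 ?opnorm_ge0.
move=> q; have [Mq|/ltW qM] := leP M (enorm q).
  apply: le_trans (Hrho q _) _; first by apply: le_trans Mq; rewrite le_max lexx.
  apply: ler_wpDr.
    by rewrite !addr_ge0 ?mulr_ge0 ?enorm_ge0 ?opnorm_ge0.
  rewrite ler_wpM2r ?enorm_ge0// ltW// hr0//.
  by apply: lt_le_trans Mq; rewrite lt_max ltrDl ltr01 orbT.
apply: ler_wpDl; first by rewrite mulr_ge0 ?enorm_ge0 ?ltW.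
rewrite (_ : grad U q - _ = (grad U q - grad U 0) + grad U 0 + - (Q *m q)); last first.
  by rewrite subrK.
apply: (le_trans (enormD _ _)); rewrite enormN; apply: lerD.
  apply: (le_trans (enormD _ _)); rewrite lerD2r; apply: (le_trans (UL _ _)).
  by rewrite subr0 ler_wpM2l.
by apply: (le_trans (enorm_mulmx _ _)); rewrite ler_wpM2l ?opnorm_ge0.
Qed.

Hypothesis gradQ : grad_sublinear.

Lemma derive_dotv_grad (q x : 'cV[R]_d) : 'D_q U x = dotv q (grad U x).
Proof.
rewrite deriveE// {1}(matrix_sum_delta q) linear_sum /dotv.
apply: eq_bigr => i _; rewrite linear_sum big_ord1 linearZ /= mxE /partial deriveE//.
Qed.

Lemma potential_ray q (s : R) :
  is_derive s 1 (fun t : R => U (t *: q)) (dotv q (grad U (s *: q))).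
Proof.
rewrite -derive_dotv_grad.
have /derivableP[] := @diff_derivable _ _ _ U _ q (dU (s *: q)).
move=> Ud _.
have E : (fun h : R =>
      h^-1 *: (((fun t : R => U (t *: q)) \o shift s) (h *: 1) - U (s *: q)))
   = (fun h : R => h^-1 *: ((U \o shift (s *: q)) (h *: q) - U (s *: q))).
  apply/funext => h; congr (_ *: (U _ - _)).
  by rewrite /= scalerDl; congr (_ *: _ + _); exact: mulr1.
split; first by rewrite /derivable E.
by rewrite /derive E.
Qed.

(** Mean value theorem on [0, 1] for s -> U(s q) - s^2/2 <q, Q q>, whose derivative pairs q with the
    gradient error at s q. *)
Lemma potential_subquadratic : forall eps, 0 < eps -> exists2 C, 0 <= C &
  forall q, `|U q - U 0 - 2^-1 * dotv q (Q *m q)| <= eps * enorm q ^+ 2 + C * enorm q.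
Proof.
move=> eps eps0; have [C C0 hC] := gradQ eps0; exists C => // q.
pose f (s : R) := U (s *: q) - 2^-1 * s ^+ 2 * dotv q (Q *m q).
pose df (s : R) := dotv q (grad U (s *: q) - Q *m (s *: q)).
have fd (s : R) : is_derive s 1 f (df s).
  have h2 := is_deriveM (is_derive_id s (1 : R)) (is_derive_id s (1 : R)).
  have h3 := @is_deriveZ R R R (id * id) (2^-1 * dotv q (Q *m q)) s 1 _ h2.
  have h := is_deriveB (potential_ray q s) h3.
  rewrite (_ : f = (fun t => U (t *: q))
      - (2^-1 * dotv q (Q *m q)) \*: (id * id)); last first.
    apply/funext => t; rewrite [RHS](_ : _ = U (t *: q) -
      (2^-1 * dotv q (Q *m q)) * (t * t))// /f; ring.
  apply: (is_derive_eq h); rewrite /df dotvDr dotvNr -scalemxAr dotvZr /GRing.scale /=.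
  by field.
have fc : {within `[0, 1], continuous f}.
  apply: derivable_within_continuous => x _.
  exact: (@ex_derive _ _ _ _ _ _ _ (fd x)).
have [s] := @MVT_segment _ f df 0 1 ler01 (fun x _ => fd x) fc.
rewrite in_itv /= => /andP[s0 s1].
rewrite /f scale1r scale0r expr0n expr1n /= !mulr1 !mulr0 !mul0r !subr0 mulr1.
rewrite -addrAC => ->; rewrite /df.
apply: (le_trans (dotv_cs _ _)); rewrite mulrC.
apply: le_trans (ler_wpM2r (enorm_ge0 _) (hC _)) _.
rewrite mulrDl lerD2r enormZ ger0_norm// expr2 -!mulrA ler_wpM2l ?(ltW eps0)//.
by rewrite ler_piMl ?mulr_ge0 ?enorm_ge0.
Qed.

(** Far out along v the gradient of U grows like m |q|, while its Lipschitz constant allows at most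
    L |q| up to a constant. *)
Lemma eigenvalue_le_lipschitz (m : R) (v : 'cV[R]_d) :
  0 <= m -> v != 0 -> Q *m v = m *: v -> m <= L.
Proof.
move=> m0 v0 Qv; rewrite leNgt; apply/negP => Lm.
have nv : 0 < enorm v.
  rewrite lt_def enorm_ge0 andbT; apply: contra_neq v0 => h.
  by apply: dotv_eq0; rewrite -enorm_sqr h expr0n.
pose eps := (m - L) / 2; have eps0 : 0 < eps by rewrite /eps; lra.
have [C C0 hC] := gradQ eps0.
pose B := C + enorm (grad U 0) + 1.
have B0 : 0 < B by rewrite /B ltr_wpDl ?addr_ge0 ?enorm_ge0.
(* With this t the two linear terms differ by exactly [B], which exceeds the constant terms by 1. *)
pose t := B / (eps * enorm v); have t0 : 0 < t by rewrite divr_gt0// mulr_gt0.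
have : m * (t * enorm v) <= (eps + L) * (t * enorm v) + C + enorm (grad U 0).
  have -> : m * (t * enorm v) = enorm (Q *m (t *: v)).
    by rewrite -scalemxAr Qv !enormZ !ger0_norm ?(ltW t0)//; ring.
  rewrite (_ : Q *m (t *: v) = - (grad U (t *: v) - Q *m (t *: v))
      + (grad U (t *: v) - grad U 0) + grad U 0); last first.
    by rewrite opprB addrA !subrK.
  apply: (le_trans (enormD _ _)); rewrite lerD2r.
  apply: (le_trans (enormD _ _)); rewrite enormN.
  apply: (le_trans (lerD (hC _) (UL _ _))).
  by rewrite subr0 !enormZ (ger0_norm (ltW t0)) mulrDl addrAC.
have -> : t * enorm v = B / eps by rewrite /t; field; rewrite ?gt_eqF.
have -> : m * (B / eps) = (eps + L) * (B / eps) + B.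
  by rewrite /eps; field; rewrite gt_eqF// subr_gt0.
rewrite -addrA lerD2l leNgt => /negP; apply.
by rewrite /B ltrDl ltr01.
Qed.
End Asymptotics.

(** * Coordinatewise limits of vector sequences *)

Section Coordinatewise.
Variable R : realType.

Definition vcvg n (u : nat -> 'cV[R]_n) (l : 'cV[R]_n) : Prop :=
  forall i, u k i 0 @[k --> \oo] --> l i 0.

Lemma cvg_dotv n (u w : nat -> 'cV[R]_n) a b : vcvg u a -> vcvg w b ->
  dotv (u k) (w k) @[k --> \oo] --> dotv a b.
Proof.
move=> ua wb; rewrite /dotv; apply: cvg_big; first exact: add_continuous.
by move=> i _; apply: cvgM.
Qed.

Lemma vcvg_mulmx n m (M : 'M[R]_(m, n)) (u : nat -> 'cV[R]_n) a : vcvg u a ->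
  vcvg (fun k => M *m u k) (M *m a).
Proof.
move=> ua i.
have E (x : 'cV[R]_n) : (M *m x) i 0 = dotv (\col_j M i j) x.
  by rewrite mxE; apply: eq_bigr => j _; rewrite mxE.
rewrite E; under eq_cvg do rewrite E.
by apply: cvg_dotv => // j; apply: cvg_cst.
Qed.

Lemma vcvgD n (u w : nat -> 'cV[R]_n) a b : vcvg u a -> vcvg w b ->
  vcvg (fun k => u k + w k) (a + b).
Proof.
move=> ua wb i; rewrite mxE; under eq_cvg do rewrite mxE.
exact: cvgD.
Qed.

Lemma vcvgZ n c (u : nat -> 'cV[R]_n) a : vcvg u a ->
  vcvg (fun k => c *: u k) (c *: a).
Proof.
move=> ua i; rewrite mxE; under eq_cvg do rewrite mxE.
by apply: cvgM => //; apply: cvg_cst.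
Qed.

Lemma vcvgN n (u : nat -> 'cV[R]_n) a : vcvg u a -> vcvg (fun k => - u k) (- a).
Proof.
move=> ua i; rewrite mxE; under eq_cvg do rewrite mxE.
exact: cvgN.
Qed.

Lemma vcvg_usubmx n m (u : nat -> 'cV[R]_(n + m)) a : vcvg u a ->
  vcvg (fun k => usubmx (u k)) (usubmx a).
Proof. by move=> ua i; rewrite mxE; under eq_cvg do rewrite mxE; exact: ua. Qed.

Lemma vcvg_dsubmx n m (u : nat -> 'cV[R]_(n + m)) a : vcvg u a ->
  vcvg (fun k => dsubmx (u k)) (dsubmx a).
Proof. by move=> ua i; rewrite mxE; under eq_cvg do rewrite mxE; exact: ua. Qed.

(** A bound eps |q| + C, rescaled by 1/(k+1) along points of size about k+1, takes exactly this
    form, with C depending on eps. *)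
Lemma cvg0_eps_harmonic (x : nat -> R) :
  (forall eps, 0 < eps -> exists C, forall k, `|x k| <= eps + C * k.+1%:R^-1) ->
  x k @[k --> \oo] --> (0 : R).
Proof.
move=> H; apply/cvgr0Pnorm_lt => e e0.
have e2 : 0 < e / 2 by rewrite divr_gt0.
have [C hC] := H _ e2.
have h : C * harmonic k @[k --> \oo] --> C * 0.
  by apply: cvgM; [exact: cvg_cst|exact: cvg_harmonic].
rewrite mulr0 in h.
have {}h : \forall k \near \oo, C * harmonic k < e / 2 by apply: cvgr_lt h _ _; lra.
near=> k; apply: (le_lt_trans (hC k)).
rewrite [ltRHS]splitr ltrD2l; near: k; exact: h.
Unshelve. all: by end_near. Qed.
End Coordinatewise.

(** * The drift inequality rescaled at infinity *)

Section LimitDrift.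
Variables (R : realType) (d : nat) (U : 'cV[R]_d -> R) (Q : 'M[R]_d).
Hypothesis dU : forall q, differentiable U q.
Hypothesis gradQ : grad_sublinear U Q.
Variable G : 'M[R]_(d + d).
Variables gamma alpha ell : R.

Lemma potdriftZ (s : R) g z :
  potdrift G gamma alpha (s *: g) (s *: z) = s ^+ 2 * potdrift G gamma alpha g z.
Proof.
have us (x : 'cV[R]_(d + d)) : usubmx (s *: x) = s *: usubmx x.
  by apply/colP => i; rewrite !mxE.
have ds (x : 'cV[R]_(d + d)) : dsubmx (s *: x) = s *: dsubmx x.
  by apply/colP => i; rewrite !mxE.
rewrite /potdrift -!scalemxAr !us !ds !scalerA ![_ * s]mulrC -!scalerA.
rewrite -!scalerN -!scalerDr !dotvZl !dotvZr; ring.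
Qed.

(** Choose z_k in the unit cube at (k+1) w. Divided by k+1, z_k tends to w and the gradient of U
    tends to Q q; divided by (k+1)^2, U tends to half its quadratic form and the constant [C]
    vanishes. *)
Lemma limit_drift (C : R) :
  (forall c : 'cV[R]_(d + d),
    exists2 z : 'cV[R]_(d + d), (forall i, c i 0 <= z i 0 <= c i 0 + 1) &
      potdrift G gamma alpha (grad U (usubmx z)) z
        + gamma * ell * potquad U G z <= C) ->
  forall w, potdrift G gamma alpha (Q *m usubmx w) w
    + gamma * ell * (2^-1 * dotv (usubmx w) (Q *m usubmx w)
                     + 2^-1 * dotv w (G *m w)) <= 0.
Proof.
move=> H w.
pose N (k : nat) : R := k.+1%:R.
have N0 k : 0 < N k by rewrite ltr0n.
have Ni k : 0 <= (N k)^-1 by rewrite invr_ge0 ltW.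
have /choice[z hz] : forall k, exists z : 'cV[R]_(d + d),
    (forall i, (N k *: w) i 0 <= z i 0 <= (N k *: w) i 0 + 1) /\
    potdrift G gamma alpha (grad U (usubmx z)) z
      + gamma * ell * potquad U G z <= C.
  by move=> k; have [z] := H (N k *: w); exists z.
pose u k := (N k)^-1 *: z k.
have us k : usubmx (u k) = (N k)^-1 *: usubmx (z k).
  by apply/colP => i; rewrite !mxE.
have uw k i : w i 0 <= u k i 0 <= w i 0 + (N k)^-1.
  have [+ _] := hz k => /(_ i); rewrite !mxE => /andP[a b].
  rewrite ler_pdivlMl// a /= ler_pdivrMl// mulrDr divff ?gt_eqF//.
have ucvg : vcvg u w.
  move=> i; apply: (@squeeze_cvgr _ _ _ _ (fun=> w i 0) (fun k => w i 0 + harmonic k)).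
  - by near=> k; exact: uw.
  - exact: cvg_cst.
  - rewrite -[X in _ --> X]addr0; apply: cvgD; first exact: cvg_cst.
    exact: cvg_harmonic.
(* A uniform bound on the rescaled positions; the sublinear estimates are applied with eps divided
   by [B] or its square. *)
have [B B0 uB] : exists2 B, 0 < B & forall k, enorm (usubmx (u k)) <= B.
  exists (\sum_i (`|w i 0| + 1) + 1) => [|k].
    by rewrite ltr_wpDl// sumr_ge0// => i _; rewrite addr_ge0.
  apply: (@le_trans _ _ (enorm (u k))).
    rewrite -(@ler_pXn2r _ 2) ?nnegrE ?enorm_ge0// !enorm_sqr.
    by rewrite [leRHS]dotv_block lerDl dotv_ge0.
  apply: (le_trans (enorm_le_sum _)); rewrite ler_wpDr//; apply: ler_sum => i _.
  have /andP[a b] := uw k i.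
  have : (N k)^-1 <= 1 by rewrite invf_le1// ler1n.
  move=> n1; rewrite ler_norml; apply/andP; split.
    apply: le_trans a; rewrite lerNl; apply: (le_trans (ler_norm _)).
    by rewrite normrN lerDl.
  by apply: (le_trans b); apply: lerD => //; exact: ler_norm.
pose g k := (N k)^-1 *: grad U (usubmx (z k)).
have gcvg : vcvg g (Q *m usubmx w).
  move=> i.
  have h := @vcvg_mulmx _ _ _ Q _ _ (vcvg_usubmx ucvg) i.
  have h0 : (g k - Q *m usubmx (u k)) i 0 @[k --> \oo] --> (0 : R).
    apply: cvg0_eps_harmonic => eps eps0.
    have [C' C0 hC] := gradQ (divr_gt0 eps0 B0).
    exists C' => k; apply: (le_trans (coord_le_enorm _ i)).
    rewrite /g us -scalemxAr -scalerBr enormZ (ger0_norm (Ni k)).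
    apply: (le_trans (ler_wpM2l (Ni k) (hC _))).
    rewrite mulrDr [X in _ + X]mulrC lerD2r mulrCA.
    rewrite -[leRHS](divfK (lt0r_neq0 B0)); apply: ler_wpM2l.
      exact: (ltW (divr_gt0 eps0 B0)).
    by apply: le_trans (uB k); rewrite us enormZ (ger0_norm (Ni k)).
  have hs := cvgD h0 h; rewrite add0r in hs.
  have E (x y : 'cV[R]_d) : (x - y) i 0 + y i 0 = x i 0.
    by rewrite -[in RHS](subrK y x) [in RHS]mxE.
  rewrite (_ : (fun k => g k i 0) = (fun k => (g k - Q *m usubmx (u k)) i 0)
      \+ (fun k => (Q *m usubmx (u k)) i 0)).
    exact: hs.
  by apply/funext => k; rewrite -[LHS](E _ (Q *m usubmx (u k))).
have Ucvg : (N k)^-1 ^+ 2 * U (usubmx (z k)) @[k --> \oo] -->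
    2^-1 * dotv (usubmx w) (Q *m usubmx w).
  have h : 2^-1 * dotv (usubmx (u k)) (Q *m usubmx (u k)) @[k --> \oo] -->
      2^-1 * dotv (usubmx w) (Q *m usubmx w).
    apply: cvgM; first exact: cvg_cst.
    by apply: cvg_dotv; [|apply: vcvg_mulmx]; apply: vcvg_usubmx.
  have h0 : (N k)^-1 ^+ 2 * U (usubmx (z k))
      - 2^-1 * dotv (usubmx (u k)) (Q *m usubmx (u k)) @[k --> \oo] --> (0 : R).
    apply: cvg0_eps_harmonic => eps eps0.
    have [C' C0 hC] := potential_subquadratic dU gradQ (divr_gt0 eps0 (exprn_gt0 2 B0)).
    exists (`|U 0| + C' * B) => k; rewrite -/(N k).
    set q := usubmx (z k).
    have uq : usubmx (u k) = (N k)^-1 *: q by exact: us.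
    have n1 : (N k)^-1 <= 1 by rewrite invf_le1// ler1n.
    have nq : (N k)^-1 * enorm q <= B.
      by have := uB k; rewrite uq enormZ (ger0_norm (Ni k)).
    rewrite uq -scalemxAr dotvZl dotvZr.
    rewrite (_ : _ - _ = (N k)^-1 ^+ 2 * (U q - U 0 - 2^-1 * dotv q (Q *m q))
       + (N k)^-1 ^+ 2 * U 0); last by ring.
    apply: (le_trans (ler_normD _ _)).
    rewrite !(normrM ((N k)^-1 ^+ 2)) !(ger0_norm (sqr_ge0 (N k)^-1)).
    apply: (@le_trans _ _ (eps + C' * B * (N k)^-1 + `|U 0| * (N k)^-1)); last first.
      by rewrite -addrA -mulrDl [C' * B + _]addrC.
    apply: lerD; last first.
      by rewrite mulrC ler_wpM2l// expr2 ler_piMl.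
    apply: (le_trans (ler_wpM2l (sqr_ge0 _) (hC q))).
    rewrite [leLHS](_ : _ = eps / B ^+ 2 * ((N k)^-1 * enorm q) ^+ 2
       + C' * ((N k)^-1 * enorm q) * (N k)^-1); last by ring.
    apply: lerD.
      rewrite -[leRHS](@divfK _ (B ^+ 2)) ?expf_neq0 ?gt_eqF//.
      apply: ler_wpM2l; first exact: (ltW (divr_gt0 eps0 (exprn_gt0 2 B0))).
      by rewrite lerXn2r ?nnegrE ?mulr_ge0 ?enorm_ge0// ltW.
    by rewrite ler_wpM2r// ler_wpM2l.
  have hs := cvgD h0 h; rewrite add0r in hs.
  rewrite (_ : (fun k => (N k)^-1 ^+ 2 * U (usubmx (z k))) =
      (fun k => (N k)^-1 ^+ 2 * U (usubmx (z k))
        - 2^-1 * dotv (usubmx (u k)) (Q *m usubmx (u k)))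
      \+ (fun k => 2^-1 * dotv (usubmx (u k)) (Q *m usubmx (u k)))).
    exact: hs.
  by apply/funext => k; rewrite /= subrK.
have lim : potdrift G gamma alpha (g k) (u k) + gamma * ell *
     ((N k)^-1 ^+ 2 * U (usubmx (z k)) + 2^-1 * dotv (u k) (G *m u k))
     @[k --> \oo] --> potdrift G gamma alpha (Q *m usubmx w) w
    + gamma * ell * (2^-1 * dotv (usubmx w) (Q *m usubmx w)
                     + 2^-1 * dotv w (G *m w)).
  apply: cvgD.
    apply: cvgD; apply: cvg_dotv.
    - apply: vcvgD; first exact: vcvg_dsubmx.
      by apply: vcvgN; apply: vcvgZ.
    - by apply: vcvgD => //; apply: vcvg_usubmx; apply: vcvg_mulmx.
    - by apply: vcvgD; apply: vcvgN => //; apply: vcvgZ; apply: vcvg_dsubmx.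
    - by apply: vcvg_dsubmx; apply: vcvg_mulmx.
  apply: cvgM; first exact: cvg_cst.
  apply: cvgD => //; apply: cvgM; first exact: cvg_cst.
  by apply: cvg_dotv => //; apply: vcvg_mulmx.
(* C/(k+1)^2 is dominated by |C|/(k+1), which is enough for the limit. *)
have Clim : `|C| * harmonic k @[k --> \oo] --> (0 : R).
  rewrite -[X in _ --> X](mulr0 `|C|); apply: cvgM; first exact: cvg_cst.
  exact: cvg_harmonic.
apply: (ler_cvg_to lim Clim); near=> k.
rewrite /= /g /u potdriftZ -scalemxAr dotvZl dotvZr.
have [_ hC] := hz k.
have n1 : (N k)^-1 <= 1 by rewrite invf_le1// ler1n.
apply: (@le_trans _ _ ((N k)^-1 ^+ 2 * C)).
  apply: le_trans (ler_wpM2l (sqr_ge0 _) hC); rewrite /potquad.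
  by rewrite le_eqVlt; apply/orP; left; apply/eqP; ring.
apply: (@le_trans _ _ ((N k)^-1 ^+ 2 * `|C|)).
  by rewrite ler_wpM2l ?sqr_ge0 ?ler_norm.
by rewrite mulrC ler_wpM2l// expr2 ler_piMl.
Unshelve. all: by end_near. Qed.
End LimitDrift.

(** * Upper bound on admissible rates *)

Section Planar.
Variable R : realFieldType.

Lemma qform_disc (a b c : R) :
  (forall x y, 0 <= a * x ^+ 2 + b * x * y + c * y ^+ 2) ->
  [/\ 0 <= a, 0 <= c & b ^+ 2 <= 4 * a * c].
Proof.
move=> H; have a0 : 0 <= a by have := H 1 0; lra.
have c0 : 0 <= c by have := H 0 1; lra.
split=> //; rewrite -subr_ge0.
have [a1|a1] := ltP 0 a.
  have := H (- b) (2 * a).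
  rewrite (_ : _ + _ = a * (4 * a * c - b ^+ 2)); last by ring.
  by rewrite pmulr_rge0.
have [c1|c1] := ltP 0 c.
  have := H (2 * c) (- b).
  rewrite (_ : _ + _ = c * (4 * a * c - b ^+ 2)); last by ring.
  by rewrite pmulr_rge0.
(* Only the mixed term is left, and at (1, - b) it equals - b^2. *)
have a2 : a = 0 by apply: le_anti; rewrite a0 a1.
have c2 : c = 0 by apply: le_anti; rewrite c0 c1.
have := H 1 (- b); rewrite a2 c2; lra.
Qed.

(* With P = [[a, b], [b, c]] and B = [[- s, 1], [- m, - g]], the hypothesis says
   that S = - P (B + xi) has a nonnegative symmetric part.  Then tr (adj P S) and
   det S are nonnegative, that is, s + g - 2 xi >= 0 and
   xi ^ 2 - (s + g) xi + (s g + m) >= 0. *)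
Lemma planar_decay_rate (a b c s m g xi : R) :
  0 < a -> 0 < c -> 0 < a * c - b ^+ 2 -> 0 <= xi ->
  (forall x y,
     (y - s * x) * (a * x + b * y) + (- (g * y) - m * x) * (b * x + c * y)
     + xi * (a * x ^+ 2 + 2 * b * x * y + c * y ^+ 2) <= 0) ->
  xi * (s + g) <= 2 * (s * g + m).
Proof.
move=> a0 c0 P0 xi0 H.
(* The rows of S are ([A1], [s12]) and ([s21], [C1]); only [s12 + s21] enters its quadratic form. *)
pose A1 := s * a + m * b - xi * a.
pose C1 := g * c - b - xi * c.
pose s12 := - (a - g * b + xi * b).
pose s21 := s * b + m * c - xi * b.
have [A0 C0 disc] : [/\ 0 <= A1, 0 <= C1 & (s12 + s21) ^+ 2 <= 4 * A1 * C1].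
  apply: qform_disc => x y; have := H x y.
  rewrite -oppr_ge0 => /le_trans; apply; rewrite /A1 /C1 /s12 /s21.
  by rewrite le_eqVlt; apply/orP; left; apply/eqP; ring.
have tr : 0 <= s + g - 2 * xi.
  rewrite -(pmulr_rge0 _ P0).
  have -> : (a * c - b ^+ 2) * (s + g - 2 * xi) = c * A1 + a * C1 - b * (s12 + s21).
    by rewrite /A1 /C1 /s12 /s21; ring.
  rewrite subr_ge0; apply: (le_trans (ler_norm _)).
  have t0 : 0 <= c * A1 + a * C1 by rewrite addr_ge0// mulr_ge0// ltW.
  rewrite -(@ler_pXn2r _ 2) ?nnegrE// real_normK ?num_real// exprMn.
  apply: (@le_trans _ _ (b ^+ 2 * (4 * A1 * C1))).
    by rewrite ler_wpM2l ?sqr_ge0.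
  apply: (@le_trans _ _ (a * c * (4 * A1 * C1))).
    by rewrite ler_wpM2r ?mulr_ge0//; lra.
  rewrite -subr_ge0 (_ : _ - _ = (c * A1 - a * C1) ^+ 2) ?sqr_ge0//; ring.
have dt : 0 <= xi ^+ 2 - (s + g) * xi + (s * g + m).
  rewrite -(pmulr_rge0 _ P0).
  have -> : (a * c - b ^+ 2) * (xi ^+ 2 - (s + g) * xi + (s * g + m)) =
      A1 * C1 - s12 * s21 by rewrite /A1 /C1 /s12 /s21; ring.
  have : 4 * (s12 * s21) <= (s12 + s21) ^+ 2.
    rewrite -subr_ge0 (_ : _ - _ = (s12 - s21) ^+ 2) ?sqr_ge0//; ring.
  by lra.
(* Adding xi times the trace inequality to twice the determinant inequality cancels xi^2. *)
have := mulr_ge0 xi0 tr; lra.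
Qed.

Lemma posdef_disc (a b c k : R) : 0 < k ->
  (forall x y, k * (x ^+ 2 + y ^+ 2) <= a * x ^+ 2 + 2 * b * x * y + c * y ^+ 2) ->
  [/\ 0 < a, 0 < c & 0 < a * c - b ^+ 2].
Proof.
move=> k0 H.
have a0 : 0 < a by have := H 1 0; lra.
have c0 : 0 < c by have := H 0 1; lra.
(* At (- b, a) the form takes the value a (a c - b^2). *)
split=> //; rewrite -(pmulr_rgt0 _ a0); have := H (- b) a.
have : 0 < k * ((- b) ^+ 2 + a ^+ 2).
  by rewrite mulr_gt0// ltr_wpDl ?sqr_ge0// exprn_gt0.
move=> /lt_le_trans/[apply]; congr (_ < _); ring.
Qed.
End Planar.

(** * Coercivity of the quadratic part of the Lyapunov function *)

Section Energy.
Variables (R : realType) (d : nat) (gamma lam : R).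

Definition energy_mx : 'M[R]_(d + d) :=
  block_mx (gamma ^+ 2 / 2 * (1 - lam))%:M (gamma / 2)%:M (gamma / 2)%:M 1%:M.

Lemma tr_energy_mx : energy_mx^T = energy_mx.
Proof. by rewrite tr_block_mx !tr_scalar_mx. Qed.

Lemma dotv_energy_mx z : dotv z (energy_mx *m z) =
  gamma ^+ 2 / 2 * (1 - lam) * dotv (usubmx z) (usubmx z)
  + gamma * dotv (usubmx z) (dsubmx z) + dotv (dsubmx z) (dsubmx z).
Proof.
have -> : energy_mx *m z = block_mx (gamma ^+ 2 / 2 * (1 - lam))%:M
    (gamma / 2)%:M (gamma / 2)%:M 1%:M *m col_mx (usubmx z) (dsubmx z).
  by rewrite vsubmxK.
rewrite mul_block_col dotv_block col_mxKu col_mxKd.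
rewrite !mul_scalar_mx scale1r !(dotvDr, dotvZr).
rewrite (dotvC (dsubmx z) (usubmx z)).
by field.
Qed.

Lemma V0E (U : 'cV[R]_d -> R) z : gamma != 0 ->
  V0 U gamma lam z = potquad U energy_mx z.
Proof.
move=> g0; rewrite /V0 /potquad; congr (_ + _).
rewrite dotv_energy_mx !enorm_sqr.
rewrite !(dotvDl, dotvDr, dotvZl, dotvZr) (dotvC (dsubmx z) (usubmx z)).
by field.
Qed.

Lemma VcorrE (U : 'cV[R]_d -> R) K alpha : gamma != 0 ->
  Vcorr U gamma lam K alpha = potquad U (energy_mx + alpha *: K).
Proof.
move=> g0; apply/funext => z; rewrite /Vcorr V0E// /potquad /corrM -addrA.
congr (_ + _); rewrite mulmxDl -scalemxAl dotvDr dotvZr; ring.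
Qed.

Hypothesis g0 : 0 < gamma.
Hypothesis lam_half : lam < 2^-1.

(** With g = gamma^2 (1 - lam), the radicand is below (g + 2)^2 exactly when gamma^2 < 2 g, that is,
    when lam < 1/2. *)
Lemma mu_min_gt0 : 0 < mu_min gamma lam.
Proof.
rewrite /mu_min mulr_gt0 ?invr_gt0// subr_gt0.
have g2 : 0 < gamma ^+ 2 by rewrite exprn_gt0.
set g := gamma ^+ 2 * (1 - lam).
have gg : gamma ^+ 2 < 2 * g.
  have : 0 < gamma ^+ 2 * (2^-1 - lam) by rewrite mulr_gt0// subr_gt0.
  by rewrite /g; lra.
rewrite -(@ltr_pXn2r _ 2) ?nnegrE ?sqrtr_ge0//; last by lra.
rewrite sqr_sqrtr; first by lra.
by rewrite addr_ge0 ?sqr_ge0// mulr_ge0// ltW.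
Qed.

Lemma c1_gt0 : 0 < c1 gamma lam.
Proof. by rewrite /c1 lt_min ltr01 mu_min_gt0. Qed.

(** The number 2 [mu_min] is the smaller eigenvalue of the 2 by 2 matrix of the form on the
    right. *)
Lemma energy_form_ge (x y : R) :
  2 * mu_min gamma lam * (x ^+ 2 + y ^+ 2)
  <= gamma ^+ 2 / 2 * (1 - lam) * x ^+ 2 + gamma * x * y + y ^+ 2.
Proof.
rewrite /mu_min; set g := gamma ^+ 2 * (1 - lam); set s := Num.sqrt _.
have g2 : 0 < gamma ^+ 2 by rewrite exprn_gt0.
have s2 : s ^+ 2 = (g - 2) ^+ 2 + 4 * gamma ^+ 2.
  by rewrite sqr_sqrtr// addr_ge0 ?sqr_ge0// mulr_ge0// ltW.
have s0 : 0 <= s by rewrite sqrtr_ge0.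
have sg : `|g - 2| < s.
  by rewrite -(@ltr_pXn2r _ 2) ?nnegrE// real_normK ?num_real// s2; lra.
(* The coefficient of x^2 in the difference of the two sides; multiplying by it completes the
   square, with no remainder in y^2. *)
pose p := (g - 2 + s) / 4; have p0 : 0 < p.
  by move: sg; rewrite /p ltr_norml => /andP[]; lra.
rewrite -subr_ge0 -(pmulr_rge0 _ p0).
rewrite (_ : p * _ = (p * x + gamma / 2 * y) ^+ 2
    + (s ^+ 2 - (g - 2) ^+ 2 - 4 * gamma ^+ 2) / 16 * y ^+ 2).
  by rewrite s2 (_ : _ - _ - _ = 0) ?mul0r ?addr0 ?sqr_ge0//; ring.
by rewrite /p /g; field.
Qed.

Lemma energy_mx_ge (z : 'cV[R]_(d + d)) :
  2 * c1 gamma lam * dotv z z <= dotv z (energy_mx *m z).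
Proof.
apply: (@le_trans _ _ (2 * mu_min gamma lam * dotv z z)).
  by rewrite ler_wpM2r ?dotv_ge0// ler_wpM2l// ge_min lexx orbT.
rewrite dotv_energy_mx dotv_block /dotv -big_split /= !mulr_sumr -!big_split /=.
apply: ler_sum => i _; have := energy_form_ge (usubmx z i 0) (dsubmx z i 0).
by lra.
Qed.
End Energy.

Section Rate.
Variables (R : realType) (d : nat) (U : 'cV[R]_d -> R) (gamma L A lam : R).
Variables (Q : 'M[R]_d) (Clin : R) (K : 'M[R]_(d + d)).

(** The smallness of alpha ensures that [alpha *: K] consumes at most half of the coercivity 2 [c1],
    so the limiting form is positive definite on the plane attached to an eigenvector v of Q, and
    [planar_decay_rate] applies there. *)
Lemma admissible_rate_le (alpha ell E : R) : (0 < d)%N -> 0 < gamma ->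
  assumption1 U gamma L A lam -> assumption2 U Q Clin -> K^T = K ->
  0 < alpha -> alpha * opnorm K <= c1 gamma lam -> 0 <= ell ->
  admissible U gamma alpha (Vcorr U gamma lam K alpha) ell E ->
  ell * gamma ^+ 2 <= 4 * (L * (1 + alpha * gamma)).
Proof.
move=> d0 g0 [[L0 A0 /andP[lam0 lam4]] [[dU _] _] UL _] asm2 Ks al0 alK ell0.
have lam2 : lam < 2^-1 by lra.
rewrite VcorrE ?gt_eqF//; set G := energy_mx d gamma lam + alpha *: K => adm.
have Gs : G^T = G by rewrite linearD linearZ /= tr_energy_mx Ks.
have gradQ := assumption2_grad_sublinear UL (ltW L0) asm2.
have [C hC] := admissible_potdrift dU Gs (ltW L0) UL (ltW g0) (ltW al0) adm.
have lim := limit_drift dU gradQ hC.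
have [_ [Qs Qpos] _] := asm2.
have [m [v [v0 Qv]]] := sym_eigenvector d0 Qs.
set n := dotv v v.
have n0 : 0 < n.
  by rewrite lt_def dotv_ge0 andbT; apply: contra_neq v0; exact: dotv_eq0.
have m0 : 0 < m.
  by have := Qpos v v0; rewrite Qv dotvZl pmulr_lgt0.
have mL := eigenvalue_le_lipschitz UL gradQ (ltW m0) v0 Qv.
pose a := m * n + dotv v (ulsubmx G *m v).
pose b := dotv v (ursubmx G *m v).
pose c := dotv v (drsubmx G *m v).
have bE : dotv v (dlsubmx G *m v) = b.
  by rewrite dotv_mulmxr trmx_dlsub Gs dotvC.
pose w x y : 'cV[R]_(d + d) := col_mx (x *: v) (y *: v).
have Gw x y : G *m w x y = col_mx (x *: (ulsubmx G *m v) + y *: (ursubmx G *m v))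
                                  (x *: (dlsubmx G *m v) + y *: (drsubmx G *m v)).
  by rewrite -{1}[G]submxK mul_block_col -!scalemxAr.
have form x y : m * n * x ^+ 2 + dotv (w x y) (G *m w x y)
    = a * x ^+ 2 + 2 * b * x * y + c * y ^+ 2.
  rewrite Gw dotv_block !col_mxKu !col_mxKd !(dotvDr, dotvZr, dotvZl) bE.
  by rewrite /a /b /c; ring.
have ww x y : dotv (w x y) (w x y) = n * (x ^+ 2 + y ^+ 2).
  by rewrite dotv_block !col_mxKu !col_mxKd !(dotvZr, dotvZl) -/n; ring.
have [|x y|a0 c0 P0] := @posdef_disc _ a b c (c1 gamma lam * n).
- by rewrite mulr_gt0// c1_gt0.
- rewrite -form; apply: ler_wpDl.
    exact: mulr_ge0 (mulr_ge0 (ltW m0) (ltW n0)) (sqr_ge0 x).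
  rewrite -mulrA -ww mulmxDl -scalemxAl dotvDr dotvZr.
  have h1 := energy_mx_ge lam g0 (w x y).
  have := dotv_mulmx_le K (w x y); rewrite ler_norml => /andP[h2 _].
  have h3 : - (c1 gamma lam * dotv (w x y) (w x y)) <= alpha * dotv (w x y) (K *m w x y).
    apply: (@le_trans _ _ (alpha * - (opnorm K * dotv (w x y) (w x y)))).
      by rewrite mulrN lerN2 mulrA ler_wpM2r ?dotv_ge0.
    by rewrite ler_wpM2l// ltW.
  by lra.
(* Here s = alpha m, g = gamma and xi = gamma ell / 2; the factor 1/2 appears because the planar
   form is twice the limiting Lyapunov function. *)
have : gamma * ell / 2 * (alpha * m + gamma) <= 2 * (alpha * m * gamma + m).
  apply: (planar_decay_rate a0 c0 P0) => [|x y].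
    by rewrite !mulr_ge0// ltW.
  apply: le_trans (lim (w x y)).
  have -> : 2^-1 * dotv (usubmx (w x y)) (Q *m usubmx (w x y))
      + 2^-1 * dotv (w x y) (G *m w x y)
      = 2^-1 * (a * x ^+ 2 + 2 * b * x * y + c * y ^+ 2).
    by rewrite -form col_mxKu -scalemxAr Qv !(dotvZr, dotvZl) -/n; ring.
  rewrite /potdrift Gw !col_mxKu !col_mxKd -!scalemxAr Qv.
  rewrite !(dotvDr, dotvDl, dotvNl, dotvZr, dotvZl) bE -/b -/c -/n.
  by rewrite /a le_eqVlt; apply/orP; left; apply/eqP; field.
move=> h; have : gamma * (gamma * ell / 2) <= 2 * (m * (1 + alpha * gamma)).
  apply: (@le_trans _ _ (gamma * ell / 2 * (alpha * m + gamma))).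
    rewrite mulrC ler_wpM2l//; last by rewrite lerDr ltW// mulr_gt0.
    by rewrite !mulr_ge0// ltW.
  by apply: (le_trans h); rewrite le_eqVlt; apply/orP; left; apply/eqP; ring.
have : m * (1 + alpha * gamma) <= L * (1 + alpha * gamma).
  by rewrite ler_wpM2r// addr_ge0// ltW// mulr_gt0.
by lra.
Qed.
End Rate.

(** * Perturbation of Lambda *)

Section Perturbation.
Variable R : realType.

(** The quadratic loss takes at most a quarter of the gain D alpha, so ell is at least lam (1 +
    gamma alpha) + 3/4 D alpha; the rest is algebra after clearing denominators. *)
Lemma Lambda_perturbation (lam gamma L J D Cl del alpha ell : R) :
  0 < lam -> 0 < gamma -> 0 < J * L -> 0 < D -> D = del - gamma * lam ->
  0 < alpha -> Cl * alpha <= D / 4 -> D * alpha <= 4 * lam ->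
  gamma * alpha <= 2 ->
  lam + del * alpha - Cl * alpha ^+ 2 <= ell ->
  0 < ell /\
  J * ((1 + alpha * gamma) * L / ell)
    <= J * ((1 + 0 * gamma) * L / lam) - 8^-1 * J * L * (D / lam ^+ 2) * alpha.
Proof.
move=> lam0 g0 JL0 D0 DE al0 Cal Dal gal hell.
have Da0 : 0 < D * alpha by exact: mulr_gt0.
have ell_ge : lam * (1 + gamma * alpha) + 3 / 4 * (D * alpha) <= ell.
  apply: le_trans hell; have : Cl * alpha * alpha <= D / 4 * alpha.
    by rewrite ler_wpM2r// ltW.
  by rewrite DE; lra.
have ga0 : 0 < gamma * alpha by exact: mulr_gt0.
have lga0 : 0 < lam * (gamma * alpha) by exact: mulr_gt0.
have ell0 : 0 < ell by lra.
split=> //; rewrite -subr_ge0.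
have -> : J * ((1 + 0 * gamma) * L / lam) - 8^-1 * J * L * (D / lam ^+ 2) * alpha
    - J * ((1 + alpha * gamma) * L / ell)
  = J * L / (8 * lam ^+ 2 * ell)
    * ((8 * lam - D * alpha) * ell - 8 * lam ^+ 2 * (1 + gamma * alpha)).
  by field; rewrite !gt_eqF.
apply: mulr_ge0.
  by rewrite divr_ge0 ?(ltW JL0)// mulr_ge0 ?(ltW ell0)// mulr_ge0 ?sqr_ge0.
have : (8 * lam - D * alpha) * (lam * (1 + gamma * alpha) + 3 / 4 * (D * alpha))
    <= (8 * lam - D * alpha) * ell.
  by rewrite ler_wpM2l//; lra.
rewrite subr_ge0; apply: le_trans; rewrite -subr_ge0.
rewrite (_ : _ - _ = D * alpha * (5 * lam - lam * (gamma * alpha)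
                                  - 3 / 4 * (D * alpha))); last by field.
rewrite mulr_ge0 ?(ltW Da0)//.
(* The last factor is at least 5 lam - 2 lam - 3 lam = 0. *)
have : lam * (gamma * alpha) <= lam * 2 by rewrite ler_wpM2l// ltW.
by lra.
Qed.

(** The slope of h at l is - h(l) (1 - 1/(2 l)). The condition involving [M] lets the Taylor
    remainder absorb at most half of the linear gain, whence the factor 1/2; monotonicity then
    passes from l - c alpha to x. *)
Lemma hfun_perturbation (l M c alpha x : R) :
  2^-1 < l -> 0 <= c -> 0 <= alpha -> c * alpha <= l / 2 ->
  (forall y, l / 2 <= y <= l -> `|hfun2 y| <= M) ->
  c * alpha * M <= Num.sqrt l * expR (- l) * (1 - (2 * l)^-1) ->
  2^-1 <= x -> x <= l - c * alpha ->
  hfun l * (1 + 2^-1 * (1 - (2 * l)^-1) * c * alpha) <= hfun x.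
Proof.
move=> l2 c0 al0 cal hM; set t := c * alpha in cal *.
have t0 : 0 <= t by exact: mulr_ge0.
have l0 : 0 < l by lra.
have s0 : 0 < Num.sqrt l by rewrite sqrtr_gt0.
have h1E : hfun1 l = - (hfun l * (1 - (2 * l)^-1)).
  rewrite /hfun1 /hfun; set e := expR _.
  rewrite (_ : (2 * l)^-1 = (2 * Num.sqrt l ^+ 2)^-1); last by rewrite sqr_sqrtr// ltW.
  by field; rewrite gt_eqF.
rewrite -/(hfun l) => tM x2 xl.
apply: le_trans (hfun_nincr x2 xl).
have tl : 0 <= t <= l / 2 by rewrite t0.
apply: le_trans (hfun_taylor l0 tl hM); rewrite h1E.
have : t * M * t <= hfun l * (1 - (2 * l)^-1) * t by rewrite ler_wpM2r.
rewrite /t; lra.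
Qed.

End Perturbation.

(** * Consequences of the thresholds on alpha *)

Section Constants.
Variables (R : realType) (d : nat) (U : 'cV[R]_d -> R) (gamma L A lam : R).
Variables (Q : 'M[R]_d) (Clin : R) (K : 'M[R]_(d + d)) (alpha_pos : R).
Hypothesis g0 : 0 < gamma.
Hypothesis L0 : 0 < L.
Hypothesis A0 : 0 < A.
Hypothesis lam0 : 0 < lam.
Hypothesis lam4 : lam <= 4^-1.

Let lam2 : lam < 2^-1. Proof. by apply: (le_lt_trans lam4); lra. Qed.

Let c10 : 0 < c1 gamma lam. Proof. exact: c1_gt0. Qed.

Lemma Ctilde_M_ge0 : 0 <= Ctilde_M gamma lam K.
Proof.
by rewrite /Ctilde_M /C_M divr_ge0 ?(ltW c10)// mulr_ge0 ?opnorm_ge0.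
Qed.

(** A positive gap forces [c_imp] to exceed lam ([Ctilde_M] + gamma), so all terms are
    nonnegative. *)
Lemma C_lam_ge0 : 0 < gapD U gamma lam Q Clin K ->
  0 <= C_lam U gamma L lam Q Clin K.
Proof.
move=> D0; have c0 : 0 <= c_imp U gamma lam Q Clin K.
  move: D0; rewrite /gapD /delta; have := mulr_gt0 g0 lam0.
  by have := mulr_ge0 (ltW lam0) Ctilde_M_ge0; lra.
rewrite /C_lam; apply: addr_ge0; last by rewrite mulr_ge0 ?Ctilde_M_ge0.
rewrite /cst2 /C_M; apply: addr_ge0 => //; apply: mulr_ge0.
  by rewrite mulr_ge0// mulr_ge0 ?opnorm_ge0.
by rewrite divr_ge0 ?(ltW c10)// addr_ge0 ?enorm_ge0 ?(ltW L0).
Qed.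

Lemma alpha1_opnorm alpha : 0 < alpha -> alpha <= alpha1 gamma L lam K alpha_pos ->
  alpha * opnorm K <= c1 gamma lam.
Proof.
move=> al0 h; have {h} : alpha <= c1 gamma lam / (2 * C_M K).
  by apply: (le_trans h); rewrite /alpha1 !ge_min lexx /= orbT.
rewrite /C_M.
have [k0|k0] := ltP 0 (opnorm K).
  have -> : 2 * (2^-1 * opnorm K) = opnorm K by field.
  by rewrite ler_pdivlMr.
move=> _; apply: le_trans (ltW c10).
by rewrite mulr_ge0_le0// ltW.
Qed.

(** Because [c1] is at most 1, the bracket inverted in [alpha0] is at least gamma^2 / 4, so gamma
    alpha is at most 2 lam. *)
Lemma alpha1_gamma alpha : 0 < alpha -> alpha <= alpha1 gamma L lam K alpha_pos ->
  gamma * alpha <= 2.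
Proof.
move=> al0; rewrite /alpha1 !le_min => /andP[/andP[+ _] _].
rewrite /alpha0; set X := (X in _ / 2 * X^-1).
have g2 : 0 < gamma ^+ 2 by rewrite exprn_gt0.
have hX : gamma ^+ 2 / 4 <= X.
  rewrite /X -addrA; apply: ler_wpDr.
    apply: addr_ge0; first by rewrite mulr_ge0 ?(ltW L0).
    apply: mulr_ge0; first by rewrite mulr_ge0// divr_ge0// ltW.
    by rewrite subr_ge0; apply: ltW; apply: (lt_trans lam2); lra.
  have : 1 <= (c1 gamma lam)^-1 by rewrite invf_ge1// /c1 ge_min lexx.
  have : 0 <= gamma ^+ 4 / 4 * (1 - lam) ^+ 2.
    by rewrite mulr_ge0 ?sqr_ge0// divr_ge0// exprn_ge0// ltW.
  by nra.
have X0 : 0 < X by apply: lt_le_trans hX; rewrite divr_gt0.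
rewrite ler_pdivlMr// => h.
have : alpha * (gamma ^+ 2 / 4) <= gamma * lam / 2.
  by apply: le_trans h; rewrite ler_wpM2l// ltW.
rewrite (_ : alpha * _ = gamma * (gamma * alpha / 4)); last by field.
rewrite -[gamma * lam / 2]mulrA ler_pM2l//; move: lam4; lra.
Qed.

(** [J2] is at least 12 / (5 gamma^2) and the other factor at least gamma^2 / 4; their product is
    3/5. *)
Lemma Lambda_ge_half alpha ell : (1 <= d)%N -> 0 < alpha -> 0 < ell ->
  ell * gamma ^+ 2 <= 4 * (L * (1 + alpha * gamma)) ->
  2^-1 <= Lambda d gamma L A lam alpha ell.
Proof.
move=> hd al0 ell0 hell; rewrite /Lambda.
have g2 : 0 < gamma ^+ 2 by rewrite exprn_gt0.
have hl : gamma ^+ 2 / 4 <= (1 + alpha * gamma) * L / ell.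
  by rewrite ler_pdivlMr//; lra.
have d1 : 1 <= d%:R :> R by rewrite ler1n.
have th0 : 0 <= theta0 gamma L by rewrite divr_ge0 ?(ltW L0) ?(ltW g2).
have hJ : 12 / 5 / gamma ^+ 2 <= J2 d gamma L A lam.
  have h1 : 1 <= 1 + 2 * theta0 gamma L + 2 * theta0 gamma L ^+ 2.
    by have := sqr_ge0 (theta0 gamma L); lra.
  have h2 : (gamma ^+ 2)^-1 <= (d%:R + A) / (gamma ^+ 2 * (1 - 2 * lam)).
    have l2 : 0 < 1 - 2 * lam by move: lam2; lra.
    rewrite -[leLHS]mul1r; apply: ler_pM; first exact: ler01.
    - by rewrite invr_ge0 ltW.
    - by apply: (le_trans d1); rewrite lerDl ltW.
    - rewrite lef_pV2 ?posrE ?mulr_gt0//.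
      by rewrite ler_piMr ?(ltW g2)//; move: lam0; lra.
  rewrite /J2; apply: ler_pM => //; first by rewrite invr_ge0 (ltW g2).
  by rewrite -[leLHS]mulr1 ler_wpM2l.
apply: (@le_trans _ _ (12 / 5 / gamma ^+ 2 * (gamma ^+ 2 / 4))).
  by rewrite (_ : _ * _ = 3 / 5); [lra|field; rewrite gt_eqF].
apply: ler_pM => //.
  by rewrite divr_ge0 ?(ltW g2).
by rewrite divr_ge0 ?(ltW g2).
Qed.

End Constants.

(** * Acceleration for small alpha *)

Unset Implicit Arguments.

Theorem theorem4p8 (R : realType) (d : nat) (hd : (1 <= d)%N)
  (gamma kappa : R) (hgamma : 0 < gamma) (hkappa : 0 < kappa < 1)
  (U : 'cV[R]_d -> R) (L A lam : R) (hU : assumption1 U gamma L A lam)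
  (Q : 'M[R]_d) (Clin : R) (hQ : assumption2 U Q Clin)
  (K : 'M[R]_(d + d)) (hK : lyapunov_solution gamma lam Q K)
  (alpha_pos : R) (hpos : alpha_pos_spec U gamma L lam Q Clin K alpha_pos)
  (lam_ : R -> R)
  (hadm : forall alpha, 0 < alpha <= alpha1 gamma L lam K alpha_pos ->
     admissible U gamma alpha (Vcorr U gamma lam K alpha) (lam_ alpha)
       (A'_ U gamma L A lam Q Clin K alpha))
  (hlam_ : forall alpha, 0 < alpha <= alpha1 gamma L lam K alpha_pos ->
     lam + delta U gamma lam Q Clin K * alpha
       - C_lam U gamma L lam Q Clin K * alpha ^+ 2 <= lam_ alpha)
  (hD : 0 < gapD U gamma lam Q Clin K)
  (hLambda0 : 2^-1 < Lambda0 d gamma L A lam) :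
  [/\ 0 < c_Lambda U gamma L A lam Q Clin K
      /\ (forall alpha,
            0 < alpha <= alpha_metric_acc U gamma L A lam Q Clin K alpha_pos ->
            Lambda d gamma L A lam alpha (lam_ alpha)
            <= Lambda0 d gamma L A lam
               - c_Lambda U gamma L A lam Q Clin K * alpha),
      exists c2 c3 : R,
        [/\ 0 < c2, 0 < c3 &
          forall alpha,
            0 < alpha <= alpha_metric_acc U gamma L A lam Q Clin K alpha_pos ->
            Lambda2 d gamma L A lam alpha (lam_ alpha)
              >= Lambda2 d gamma L A lam 0 lam * (1 + c2 * alpha)
            /\ Lambda3 d gamma L A lam kappa alpha (lam_ alpha)
              >= Lambda3 d gamma L A lam kappa 0 lam * (1 + c3 * alpha)] &
      0 < c3_star U gamma L A lam Q Clin K /\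
      forall c3 : R, 0 < c3 < c3_star U gamma L A lam Q Clin K ->
        forall alpha,
          0 < alpha <= alpha_metric_acc U gamma L A lam Q Clin K alpha_pos ->
          Lambda2 d gamma L A lam alpha (lam_ alpha)
            >= Lambda2 d gamma L A lam 0 lam * (1 + (gamma + c3) * alpha)
          /\ Lambda3 d gamma L A lam kappa alpha (lam_ alpha)
            >= Lambda3 d gamma L A lam kappa 0 lam * (1 + c3 * alpha)].

Proof.
have [[L0 A0 /andP[lam0 lam4]] _ _ _] := hU.
have [Ks _] := hK.
set D := gapD U gamma lam Q Clin K in hD *.
set Cl := C_lam U gamma L lam Q Clin K in hlam_ *.
set l := Lambda0 d gamma L A lam in hLambda0 *.
set J := J2 d gamma L A lam.
set a_acc := alpha_metric_acc U gamma L A lam Q Clin K alpha_pos.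
set cL := c_Lambda U gamma L A lam Q Clin K.
have Cl0 : 0 <= Cl by exact: C_lam_ge0.
have l0 : 0 < l by lra.
have JL0 : 0 < J * L.
  move: l0; rewrite /l /Lambda0 /Lambda mul0r addr0 mul1r mulrA -/J.
  by rewrite pmulr_lgt0// invr_gt0.
have lE : l = J * L / lam.
  by rewrite /l /Lambda0 /Lambda mul0r addr0 mul1r mulrA.
have cL0 : 0 < cL.
  rewrite /cL /c_Lambda -/J -/D -[X in X * _]mulrA mulr_gt0//.
    by rewrite mulr_gt0 ?invr_gt0.
  by rewrite divr_gt0// exprn_gt0.
have q0 : 0 < 1 - (2 * l)^-1.
  have l1 : 1 < 2 * l by rewrite -ltr_pdivrMl// mulr1.
  by rewrite subr_gt0 invf_lt1// (lt_trans ltr01).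
have cs0 : 0 < c3_star U gamma L A lam Q Clin K.
  by apply: mulr_gt0 => //; apply: mulr_gt0 => //; rewrite invr_gt0.
set Mh := M_h d gamma L A lam.
have hM y : l / 2 <= y <= l -> `|hfun2 y| <= Mh by exact: hfun2_le_sup.
have Mh0 : 0 <= Mh.
  by apply: le_trans (hM l _); rewrite ?normr_ge0// lexx andbT; lra.
have acc alpha : 0 < alpha -> alpha <= a_acc ->
  [/\ alpha <= alpha1 gamma L lam K alpha_pos, Cl * alpha <= D / 4,
      D * alpha <= 4 * lam &
      cL * alpha * Mh <= Num.sqrt l * expR (- l) * (1 - (2 * l)^-1)].
  move=> al0 hal.
  have [m1 m2] : alpha <= Num.min (Num.min (alpha1 gamma L lam K alpha_pos) 1)
      (Num.min (4 * lam / D)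
        (8 * lam ^+ 2 * Num.sqrt l * expR (- l) * (1 - (2 * l)^-1)
          / (J * L * D * Mh))) /\ Cl * alpha <= D / 4.
    move: hal; rewrite /a_acc /alpha_metric_acc -/D -/Cl -/l -/J -/Mh.
    case: eqP => [->|/eqP Cn] hal; first by rewrite mul0r divr_ge0 ?(ltW hD).
    split; first by apply: (le_trans hal); rewrite ge_min lexx.
    have Cp : 0 < Cl by rewrite lt_def Cn.
    have : alpha <= D / (4 * Cl).
      by apply: (le_trans hal); rewrite ge_min (ge_min _ (D / _)) lexx orbT.
    rewrite ler_pdivlMr ?mulr_gt0//; lra.
  split=> //.
  - by apply: (le_trans m1); rewrite ge_min (ge_min _ (alpha1 _ _ _ _ _)) lexx.
  - have : alpha <= 4 * lam / D.
      by apply: (le_trans m1); rewrite ge_min (ge_min _ (4 * lam / D)) lexx orbT.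
    by rewrite ler_pdivlMr// mulrC.
  have : alpha <= 8 * lam ^+ 2 * Num.sqrt l * expR (- l) * (1 - (2 * l)^-1)
      / (J * L * D * Mh).
    by apply: (le_trans m1); rewrite !ge_min lexx !orbT.
  (* If [Mh] were 0, the quotient would be 0 by convention, contradicting 0 < alpha. *)
  have [M0|M0] := eqVneq Mh 0.
    by rewrite M0 mulr0 invr0 mulr0 => /(lt_le_trans al0); rewrite ltxx.
  have Mp : 0 < Mh by rewrite lt_def M0.
  rewrite (ler_pdivlMr _ _ (mulr_gt0 (mulr_gt0 JL0 hD) Mp)) => h.
  have l8 : 0 < 8 * lam ^+ 2 by rewrite mulr_gt0// exprn_gt0.
  rewrite -(ler_pM2l l8).
  rewrite (_ : _ * _ = alpha * (J * L * D * Mh)).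
    by apply: (le_trans h); rewrite !mulrA.
  by rewrite /cL /c_Lambda -/J -/D; field; rewrite gt_eqF.
have part1 alpha : 0 < alpha <= a_acc -> 0 < lam_ alpha /\
    Lambda d gamma L A lam alpha (lam_ alpha) <= l - cL * alpha.
  move=> /andP[al0 hal]; have [h1 h2 h3 _] := acc _ al0 hal.
  apply: (Lambda_perturbation lam0 hgamma JL0 hD erefl al0 h2 h3).
    exact: alpha1_gamma h1.
  by apply: hlam_; rewrite al0.
have part3 c3 : 0 < c3 < c3_star U gamma L A lam Q Clin K ->
    forall alpha, 0 < alpha <= a_acc ->
      Lambda2 d gamma L A lam alpha (lam_ alpha)
        >= Lambda2 d gamma L A lam 0 lam * (1 + (gamma + c3) * alpha)
      /\ Lambda3 d gamma L A lam kappa alpha (lam_ alpha)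
        >= Lambda3 d gamma L A lam kappa 0 lam * (1 + c3 * alpha).
  move=> /andP[c30 c3s] alpha hal; have /andP[al0 al1] := hal.
  have [h1 h2 h3 h4] := acc _ al0 al1; have [ell0 hL] := part1 _ hal.
  have a1 : 0 < alpha <= alpha1 gamma L lam K alpha_pos by rewrite al0.
  have rate := admissible_rate_le hd hgamma hU hQ Ks al0
    (alpha1_opnorm hgamma lam4 al0 h1)
    (ltW ell0) (hadm _ a1).
  have half := Lambda_ge_half hgamma L0 A0 lam0 lam4 hd al0 ell0 rate.
  (* Since l = J L / lam, this is D alpha <= 4 lam rescaled; it keeps the Taylor interval within
     [l/2, l], where [Mh] controls the remainder. *)
  have cal : cL * alpha <= l / 2.
    rewrite lE /cL /c_Lambda -/J -/D.
    rewrite (_ : _ * alpha = J * L / (8 * lam ^+ 2) * (D * alpha)); last first.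
      by field; rewrite gt_eqF.
    rewrite (_ : _ / 2 = J * L / (8 * lam ^+ 2) * (4 * lam)); last first.
      by field; rewrite gt_eqF.
    by rewrite ler_wpM2l// divr_ge0 ?(ltW JL0)// mulr_ge0 ?sqr_ge0.
  have h0 : 0 < hfun l by rewrite /hfun mulr_gt0 ?expR_gt0 ?sqrtr_gt0.
  have key : hfun l * (1 + c3 * alpha)
      <= hfun (Lambda d gamma L A lam alpha (lam_ alpha)).
    apply: le_trans (hfun_perturbation hLambda0 (ltW cL0) (ltW al0) cal hM h4 half hL).
    by rewrite ler_wpM2l ?(ltW h0)// lerD2l ler_wpM2r ?(ltW al0) ?(ltW c3s).
  have [k0 _] := andP hkappa.
  have ca0 : 0 <= c3 * alpha by rewrite mulr_ge0 ?(ltW al0) ?(ltW c30).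
  split; last first.
    by rewrite /Lambda3 -/l -mulrA ler_wpM2l ?(ltW k0).
  rewrite /Lambda2 -/(Lambda0 d gamma L A lam) -/l /L_eff mul0r addr0 mul1r.
  have Lg : 0 <= L / gamma ^+ 2 by rewrite divr_ge0 ?(ltW L0) ?sqr_ge0.
  have ag0 : 0 <= alpha * gamma by rewrite mulr_ge0// ltW.
  rewrite -[X in _ <= _ * X]mulrA [leRHS]mulrA.
  rewrite -mulrA [L / _ * _]mulrC mulrA ler_wpM2r//.
  (* The gain from h multiplies the factor 1 + alpha gamma of [L_eff]; dropping the nonnegative
     cross term leaves the rate gamma + c3. *)
  apply: (@le_trans _ _ (hfun l * (1 + c3 * alpha) * (1 + alpha * gamma))).
    rewrite -mulrA ler_wpM2l ?(ltW h0)//.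
    have := mulr_ge0 ca0 ag0; lra.
  by rewrite ler_wpM2r// addr_ge0.
split.
- by split=> // alpha /part1[].
- have cs2 : 0 < c3_star U gamma L A lam Q Clin K / 2
      < c3_star U gamma L A lam Q Clin K by lra.
  exists (gamma + c3_star U gamma L A lam Q Clin K / 2),
    (c3_star U gamma L A lam Q Clin K / 2); split; [lra|lra|].
  exact: part3.
- by split.
Qed.
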